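(* Let $(M,g,Q)$ be a $3$-dimensional Riemannian manifold with circulant structure $Q$ (as defined in the context) and let $\tilde g$ be the associated metric. The Ricci tensors $\rho$ of $g$ and $\tilde\rho$ of $\tilde g$ and the scalar quantities $\tau,\tau^{*},\tilde\tau,\tilde\tau^{*}$ satisfy $$\tilde{\rho}(x,y) = \rho(x,y)+\frac{1}{3}(\tilde{\tau}^{*}-\tau)g(x,y)+\frac{1}{6}(2\tilde{\tau}-2\tau^{*}+\tilde{\tau}^{*}-\tau)\tilde{g}(x,y)$$ for all vector fields $x,y$ on $M$.
   Context: Manifold $(M,g,Q)$: $M$ is a $3$-dimensional Riemannian manifold with metric $g$ and a $(1,1)$-tensor field $Q$ satisfying $Q^3=\mathrm{id}$, $Q\neq \mathrm{id}$ and $g(Qx,Qy)=g(x,y)$, such that around every point there are local coordinates $(x^1,x^2,x^3)$ with coordinate basis $e_i=\partial/\partial x^i$ in which $Q$ has the constant circulant matrix $(Q_j^s)=\begin{pmatrix}0&1&0\\ 0&0&1\\ 1&0&0\end{pmatrix}$, where $Qe_j=Q_j^s e_s$ (that is, $Qe_1=e_2$, $Qe_2=e_3$, $Qe_3=e_1$). Necessarily, in this basis $g$ has matrix $(g_{ij})=\begin{pmatrix}A & B & B \\ B & A & B \\ B & B & A\end{pmatrix}$ with $A,B$ smooth functions; it is assumed that $A>B>0$. Associated metric: $\tilde g(x,y)=g(x,Qy)+g(Qx,y)$ (a non-degenerate, indefinite metric). $\nabla$ and $\tilde\nabla$ are the Levi-Civita connections of $g$ and $\tilde g$. Curvature conventions: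 $R(x,y)z=\nabla_x\nabla_yz-\nabla_y\nabla_xz-\nabla_{[x,y]}z$, $R(x,y,z,u)=g(R(x,y)z,u)$; $\tilde R$ is defined in the same way from $\tilde\nabla$ and $\tilde g$. With $(g^{ij})$, $(\tilde g^{ij})$ the inverse matrices of $(g(e_i,e_j))$, $(\tilde g(e_i,e_j))$ for a basis $\{e_i\}$ of the tangent space and the summation convention: $$\rho(y,z)=g^{ij}R(e_i,y,z,e_j),\quad \tau=g^{ij}\rho(e_i,e_j),\quad \tilde\rho(y,z)=\tilde g^{ij}\tilde R(e_i,y,z,e_j),\quad \tilde\tau=\tilde g^{ij}\tilde\rho(e_i,e_j),$$ $$\tau^{*}=\tilde g^{ij}\rho(e_i,e_j),\quad \tilde\tau^{*}=g^{ij}\tilde\rho(e_i,e_j).$$ *)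

(* Defs.v *)
From HB Require Import structures.
From mathcomp Require Import all_boot all_order all_algebra.
From mathcomp Require Import all_classical all_reals all_analysis.

Set Implicit Arguments.
Unset Strict Implicit.
Unset Printing Implicit Defensive.

Import Order.TTheory GRing.Theory Num.Theory.
Import numFieldNormedType.Exports.

Local Open Scope classical_set_scope.
Local Open Scope ring_scope.

(* Meant for open U. *)
Fixpoint Ck (R : realType) (V W : normedModType R) (n : nat) (U : set V)
    (f : V -> W) : Prop :=
  if n is m.+1 then
    (forall x, U x -> differentiable f x) /\ (forall v, Ck m U ('D_v f))
  else forall x, U x -> {for x, continuous f}.

Definition smooth_on (R : realType) (V W : normedModType R) (U : set V)
    (f : V -> W) : Prop := forall n, Ck n U f.

Definition smooth_near (R : realType) (V W : normedModType R)
    (f : V -> W) (x : V) : Prop :=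
  exists U : set V, [/\ open U, U x & smooth_on U f].

(* A chart is a homeomorphism from an open set of M onto an open set of R^3,
   with inverse cinv; the values of cmap and cinv elsewhere are irrelevant. *)
Record chart (R : realType) (M : topologicalType) := Chart {
  cdom : set M;
  cmap : M -> 'rV[R]_3;
  cinv : 'rV[R]_3 -> M;
  cdom_open : open cdom;
  cimg_open : open (cmap @` cdom);
  cmapK : forall p, cdom p -> cinv (cmap p) = p;
  cmap_continuous : forall p, cdom p -> {for p, continuous cmap};
  cinv_continuous :
    forall y, (cmap @` cdom) y -> {for y, continuous cinv} }.

Definition transition (R : realType) (M : topologicalType) (c d : chart R M) :
  'rV[R]_3 -> 'rV[R]_3 := cmap d \o cinv c.

Definition compatible (R : realType) (M : topologicalType) (c d : chart R M) :
    Prop :=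
  smooth_on (cmap c @` (cdom c `&` cdom d)) (transition c d) /\
  smooth_on (cmap d @` (cdom c `&` cdom d)) (transition d c).

(* The atlas is presented with a preferred chart chart_at p around each p. *)
Record manifold3 (R : realType) := Manifold3 {
  mcarrier :> topologicalType;
  mhausdorff : hausdorff_space mcarrier;
  msecond_countable : @second_countable mcarrier;
  chart_at : mcarrier -> chart R mcarrier;
  chart_at_dom : forall p, cdom (chart_at p) p;
  chart_at_compatible : forall p q, compatible (chart_at p) (chart_at q) }.

Section Manifold.
Variables (R : realType) (M : manifold3 R).

(* Membership in the maximal atlas. *)
Definition smooth_chart (c : chart R M) : Prop :=
  forall p : M, compatible c (chart_at p).

(* T_pM is identified with R^3 by means of the coordinate basis of chart_at p:
   tensor fields on M are families of tensors on R^3 indexed by M, with no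
   regularity built in. *)
Definition vfield := M -> 'rV[R]_3.
Definition endofield := M -> 'rV[R]_3 -> 'rV[R]_3.
Definition formfield := M -> 'rV[R]_3 -> 'rV[R]_3 -> R.

(* Sends the components in c of a tangent vector at p to those in d. *)
Definition tangent_change (c d : chart R M) (p : M) (u : 'rV[R]_3) :
  'rV[R]_3 := 'D_u (transition c d) (cmap c p).

Definition coord_field (c : chart R M) (i : 'I_3) : vfield :=
  fun p => tangent_change c (chart_at p) p (delta_mx 0 i).

(* The components of X in c, as functions of the coordinates of c. *)
Definition components (c : chart R M) (X : vfield) : 'rV[R]_3 -> 'rV[R]_3 :=
  fun y => let p := cinv c y in tangent_change (chart_at p) c p (X p).

Definition smooth_fun_at (f : M -> R) (p : M) : Prop :=
  smooth_near (f \o cinv (chart_at p) : 'rV[R]_3 -> R^o) (cmap (chart_at p) p).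

Definition smooth_vfield_at (X : vfield) (p : M) : Prop :=
  smooth_near (components (chart_at p) X) (cmap (chart_at p) p).

Definition smooth_vfield (X : vfield) : Prop :=
  forall p, smooth_vfield_at X p.

Definition vderive (X : vfield) (f : M -> R) : M -> R :=
  fun p => 'D_(X p) (f \o cinv (chart_at p) : 'rV[R]_3 -> R^o)
             (cmap (chart_at p) p).

(* [X, Y]^k = X^i d_i Y^k - Y^i d_i X^k *)
Definition lie_bracket (X Y : vfield) : vfield :=
  fun p => let c := chart_at p in
    'D_(X p) (components c Y) (cmap c p) -
    'D_(Y p) (components c X) (cmap c p).

Definition apply_form (h : formfield) (X Y : vfield) : M -> R :=
  fun p => h p (X p) (Y p).

Definition apply_endo (Q : endofield) (X : vfield) : vfield :=
  fun p => Q p (X p).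

Record riemannian_metric (g : formfield) : Prop := RiemannianMetric {
  metric_linear_l : forall p v, scalar (fun u => g p u v);
  metric_linear_r : forall p u, scalar (g p u);
  metric_sym : forall p u v, g p u v = g p v u;
  metric_pos : forall p u, u != 0 -> 0 < g p u u;
  metric_smooth : forall X Y p,
    smooth_vfield_at X p -> smooth_vfield_at Y p ->
    smooth_fun_at (apply_form g X Y) p }.

(* Row j holds the coordinates of Q e_j: Q e_0 = e_1, Q e_1 = e_2,
   Q e_2 = e_0. *)
Definition circulant_mx : 'M[R]_3 :=
  \matrix_(j, s) ((s : nat) == (j.+1 %% 3)%N)%:R.

Record circulant_structure (g : formfield) (Q : endofield) : Prop :=
    CirculantStructure {
  circ_linear : forall p, linear (Q p);
  circ_smooth : forall X p, smooth_vfield_at X p ->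
    smooth_vfield_at (apply_endo Q X) p;
  circ_cube : forall p u, Q p (Q p (Q p u)) = u;
  circ_neq_id : exists p u, Q p u <> u;
  circ_isometry : forall p u v, g p (Q p u) (Q p v) = g p u v;
  (* With A := g(e_0, e_0) and B := g(e_0, e_1), the matrix of g in the
     coordinates c is A on the diagonal and B elsewhere, because Q is an
     isometry; the last condition says A > B > 0. *)
  circ_coordinates : forall p, exists c : chart R M,
    [/\ smooth_chart c, cdom c p,
        forall q, cdom c q -> forall j,
          Q q (coord_field c j q) =
          \sum_(s < 3) circulant_mx j s *: coord_field c s q &
        forall q, cdom c q ->
          0 < g q (coord_field c 0 q) (coord_field c 1 q)
            < g q (coord_field c 0 q) (coord_field c 0 q)] }.

Definition associated_metric (g : formfield) (Q : endofield) : formfield :=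
  fun p u v => g p u (Q p v) + g p (Q p u) v.

(* A connection is local, so it acts on fields that are smooth only near a
   point; the axioms below are imposed at p on all fields smooth near p, and
   the values on other fields are irrelevant. *)
Definition connection := vfield -> vfield -> vfield.

Record affine_connection (nabla : connection) : Prop := AffineConnection {
  conn_smooth : forall X Y p, smooth_vfield_at X p -> smooth_vfield_at Y p ->
    smooth_vfield_at (nabla X Y) p;
  conn_addl : forall X1 X2 Y p, smooth_vfield_at X1 p ->
    smooth_vfield_at X2 p -> smooth_vfield_at Y p ->
    nabla (fun q => X1 q + X2 q) Y p = nabla X1 Y p + nabla X2 Y p;
  conn_scalel : forall (f : M -> R) X Y p, smooth_fun_at f p ->
    smooth_vfield_at X p -> smooth_vfield_at Y p ->
    nabla (fun q => f q *: X q) Y p = f p *: nabla X Y p;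
  conn_addr : forall X Y1 Y2 p, smooth_vfield_at X p ->
    smooth_vfield_at Y1 p -> smooth_vfield_at Y2 p ->
    nabla X (fun q => Y1 q + Y2 q) p = nabla X Y1 p + nabla X Y2 p;
  conn_leibniz : forall (f : M -> R) X Y p, smooth_fun_at f p ->
    smooth_vfield_at X p -> smooth_vfield_at Y p ->
    nabla X (fun q => f q *: Y q) p =
    vderive X f p *: Y p + f p *: nabla X Y p }.

Record levi_civita (h : formfield) (nabla : connection) : Prop := LeviCivita {
  lc_affine : affine_connection nabla;
  lc_torsion_free : forall X Y p, smooth_vfield_at X p ->
    smooth_vfield_at Y p ->
    nabla X Y p - nabla Y X p = lie_bracket X Y p;
  lc_metric : forall X Y Z p, smooth_vfield_at X p -> smooth_vfield_at Y p ->
    smooth_vfield_at Z p ->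
    vderive X (apply_form h Y Z) p =
    h p (nabla X Y p) (Z p) + h p (Y p) (nabla X Z p) }.

Definition curvature (nabla : connection) (X Y Z : vfield) : vfield :=
  fun p => nabla X (nabla Y Z) p - nabla Y (nabla X Z) p
           - nabla (lie_bracket X Y) Z p.

Definition curvature4 (h : formfield) (nabla : connection)
    (X Y Z U : vfield) : M -> R :=
  apply_form h (curvature nabla X Y Z) U.

(* A basis of T_pM, extended to fields smooth near p so that the curvature
   operator can be applied to it. *)
Definition local_frame_at (e : 'I_3 -> vfield) (p : M) : Prop :=
  (forall i, smooth_vfield_at (e i) p) /\ row_free (\matrix_(i < 3) e i p).

Definition gram (h : formfield) (e : 'I_3 -> vfield) (p : M) : 'M[R]_3 :=
  \matrix_(i, j) apply_form h (e i) (e j) p.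

(* h^{ij} T(e_i, e_j) *)
Definition metric_trace (h : formfield) (e : 'I_3 -> vfield)
    (T : vfield -> vfield -> M -> R) (p : M) : R :=
  \sum_(i < 3) \sum_(j < 3) invmx (gram h e p) i j * T (e i) (e j) p.

Definition ricci (h : formfield) (nabla : connection) (e : 'I_3 -> vfield)
    (Y Z : vfield) : M -> R :=
  metric_trace h e (fun U V => curvature4 h nabla U Y Z V).

End Manifold.

(* Main.v *)
Require Import Defs.
From HB Require Import structures.
From mathcomp Require Import all_boot all_order all_algebra.
From mathcomp Require Import all_classical all_reals all_analysis.
From mathcomp Require Import ring lra.

Set Implicit Arguments.
Unset Strict Implicit.
Unset Printing Implicit Defensive.

Import Order.TTheory GRing.Theory Num.Theory.
Import numFieldNormedType.Exports.

Local Open Scope classical_set_scope.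
Local Open Scope ring_scope.

(** Write E_0, E_1, E_2 for the coordinate fields of a chart adapted to Q, and
    gt for the metric associated to g.  Since Q is an isometry that permutes
    the E_i cyclically, the Gram matrices of g and gt in this basis are
    (A - B) I + B J and (B - A) I + (A + B) J, where J is the all-one matrix
    (circulant_gram, associated_gram).  Hence the directions with constant
    coefficients

      F_0 = E_0 + E_1 + E_2,   F_1 = E_0 - E_1,   F_2 = E_0 + E_1 - 2 E_2,

    that is the axis of Q and two directions of the plane that Q rotates, are
    orthogonal for both metrics, with squares (m_0, m_1, 3 m_1) for g and
    (2 m_0, - m_1, - 3 m_1) for gt (axis_plane_diagonal): the two metrics differ
    by one constant factor along the axis and another one along the plane.

    In a commuting frame the Ricci tensor of a diagonal metric is an explicit
    expression in the diagonal entries and their first two derivatives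
    (frame_curvature).  Two facts can be read off it.  Its off-diagonal entries
    do not see constant factors in the entries of the metric
    (diag_ricci_off_rescale).  And if the metric on the plane is a function
    times a constant one, then such factors change the plane part of the Ricci tensor by a
    multiple of the plane part of the metric (diag_ricci_rescale).  So the
    difference of the two Ricci tensors lies in the span of g and gt, and its
    two coefficients are determined by its two traces, because the g-trace of
    gt is 2 - 1 - 1 = 0 and the gt-trace of g is 1/2 - 1 - 1 = - 3/2
    (trace_coefficients).

    The remaining work is to reduce the statement, which speaks of arbitrary
    fields and of traces in an arbitrary local frame, to this computation at one
    point.  Smoothness, directional derivatives and brackets are transported
    between charts; fields with constant components in a chart commute by the
    symmetry of second derivatives (lie_bracket_const); and the curvature is
    linear over functions in each argument, so that it depends only on the
    values of the fields at the point (curvature_tensorial1 to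
    curvature_tensorial3).  Locality of a connection is obtained from its
    Leibniz rule by multiplying with the indicator function of a neighbourhood,
    which is smooth at the point in question (tensorial_near, nabla_near). *)

(** * Smooth maps between normed spaces *)

Section Local.
Variables (R : realType) (V W : normedModType R).
Implicit Types (f g : V -> W) (U : set V).

Lemma near_eq_differentiable f g x :
  (\near x, f x = g x) -> differentiable f x -> differentiable g x.
Proof.
move=> fg df.
have gfx : g x = f x by rewrite (nbhs_singleton fg).
have E : g \o shift x = cst (g x) + 'd f x +o_ (0 : V) id.
  have /diff_locallyP [_ Ef] := df.
  apply/eqaddoP => e e0; move/eqaddoP: Ef => /(_ e e0).
  have := fg; rewrite (near_shift 0 x) /= => fg0; apply: filterS2 fg0.
  by move=> y /=; rewrite subr0 !fctE /= gfx => ->.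
have dE := diff_unique (diff_continuous df) E.
by apply/diff_locallyP; rewrite dE; split => //; exact: diff_continuous.
Qed.

Lemma near_open U x (P : V -> Prop) : open U -> U x -> (forall y, U y -> P y) ->
  \near x, P x.
Proof. by move=> oU Ux H; apply: filterS (open_nbhs_nbhs (conj oU Ux)). Qed.

Lemma near_ex_open x (P : V -> Prop) : (\forall y \near x, P y) ->
  exists A : set V, [/\ open A, A x & forall y, A y -> P y].
Proof. by rewrite /prop_near1 nbhsE => -[A [oA Ax] AP]; exists A; split. Qed.

Lemma Ck_eq n U f g : open U -> (forall x, U x -> f x = g x) ->
  Ck n U f -> Ck n U g.
Proof.
move=> oU; elim: n f g => [|n IHn] f g fg /=.
  move=> cf x Ux; have nfg := near_open oU Ux fg.
  have E := nbhs_singleton nfg.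
  rewrite /prop_for /continuous_at -E.
  by apply: cvg_trans (cf x Ux); apply: near_eq_cvg.
move=> [df cf]; split=> [x Ux|v].
  exact: near_eq_differentiable (near_open oU Ux fg) (df x Ux).
apply: IHn (cf v) => x Ux; apply: near_eq_derive; exact: near_open oU Ux fg.
Qed.

Lemma CkS n U f : Ck n.+1 U f -> Ck n U f.
Proof.
elim: n f => [|n IHn] f [df cf] /=.
  by move=> x Ux; apply: differentiable_continuous; exact: df.
by split=> // v; apply: IHn; exact: cf.
Qed.

Lemma CkW n U U' f : U' `<=` U -> Ck n U f -> Ck n U' f.
Proof.
move=> UU; elim: n f => [|n IHn] f /=; first by move=> H x /UU; exact: H.
by move=> [df cf]; split=> [x /UU|v]; [exact: df|apply: IHn; exact: cf].
Qed.

Lemma Ck_cst n U (a : W) : Ck n U (cst a).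
Proof.
elim: n a => [|n IHn] a /=; first by move=> x _; exact: cst_continuous.
split=> [x _|v]; first exact: differentiable_cst.
by rewrite (_ : 'D_v (cst a) = cst 0) //; apply/funext => x; rewrite derive_cst.
Qed.

Lemma Ck_add n U f g : open U -> Ck n U f -> Ck n U g -> Ck n U (fun x => f x + g x).
Proof.
move=> oU; elim: n f g => [|n IHn] f g /=.
  by move=> cf cg x Ux; apply: cvgD; [exact: cf|exact: cg].
move=> [df cf] [dg cg]; split=> [x Ux|v].
  by apply: differentiableD; [exact: df|exact: dg].
apply: (@Ck_eq _ _ (fun x => 'D_v f x + 'D_v g x)) => //; last exact: IHn (cf v) (cg v).
by move=> x Ux; rewrite -deriveD //; apply: diff_derivable; [exact: df|exact: dg].
Qed.

Lemma smooth_onW U U' f : U' `<=` U -> smooth_on U f -> smooth_on U' f.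
Proof. by move=> UU sf n; apply: CkW UU (sf n). Qed.

Lemma smooth_near_eq f g x : (\near x, f x = g x) -> smooth_near f x -> smooth_near g x.
Proof.
move=> /near_ex_open[A [oA Ax fg]] [U [oU Ux sf]].
exists (A `&` U); split; [exact: openI|by []|].
move=> n; apply: (@Ck_eq n _ f) => [|y [Ay _]|]; [exact: openI|exact: fg|].
by apply: CkW (sf n); exact: subIsetr.
Qed.

Lemma smooth_near_cst (a : W) (x : V) : smooth_near (fun _ => a) x.
Proof. by exists setT; split=> //; [exact: openT|move=> n; exact: Ck_cst]. Qed.

Lemma smooth_near_add f g x : smooth_near f x -> smooth_near g x ->
  smooth_near (fun y => f y + g y) x.
Proof.
move=> [A [oA Ax sf]] [B [oB Bx sg]]; exists (A `&` B); split; [exact: openI|by []|].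
move=> n; apply: Ck_add; first exact: openI.
  by apply: CkW (sf n); exact: subIsetl.
by apply: CkW (sg n); exact: subIsetr.
Qed.

Lemma smooth_near_sum (I : Type) (r : seq I) (f : I -> V -> W) x :
  (forall i, smooth_near (f i) x) -> smooth_near (fun y => \sum_(i <- r) f i y) x.
Proof.
move=> sf; elim: r => [|i r IHr].
  by under eq_fun do rewrite big_nil; exact: smooth_near_cst.
by under eq_fun do rewrite big_cons; apply: smooth_near_add.
Qed.

Lemma smooth_near_derive f v x : smooth_near f x -> smooth_near ('D_v f) x.
Proof. by move=> [U [oU Ux sf]]; exists U; split=> // n; have [_] := sf n.+1; apply. Qed.

Lemma smooth_near_near f x : smooth_near f x -> \near x, smooth_near f x.
Proof. by move=> [U [oU Ux sf]]; apply: (near_open oU Ux) => y Uy; exists U. Qed.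

Lemma smooth_near_diff f x : smooth_near f x -> differentiable f x.
Proof. by move=> [U [_ Ux sf]]; have [df _] := sf 1%N; exact: df. Qed.

Lemma smooth_near_diff_near f x : smooth_near f x -> \near x, differentiable f x.
Proof. by move=> /smooth_near_near; apply: filterS => y; exact: smooth_near_diff. Qed.

End Local.

Section Product.
Variables (R : realType) (V : normedModType R).

(** By induction on n: the derivative of a product is a sum of products of maps
    of class n. *)
Lemma Ck_mul n (U : set V) (f g : V -> R^o) : open U ->
  Ck n U f -> Ck n U g -> Ck n U (fun x => f x * g x : R^o).
Proof.
move=> oU; elim: n f g => [|n IHn] f g.
  by move=> cf cg x Ux; apply: cvgM; [exact: cf|exact: cg].
move=> cf1 cg1; have := cf1; have := cg1 => -[dg cg] [df cf]; split=> [x Ux|v].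
  by apply: differentiableM; [exact: df|exact: dg].
apply: (@Ck_eq _ _ _ _ _ (fun x => f x * 'D_v g x + g x * 'D_v f x)) => //.
  move=> x Ux; symmetry; apply: deriveM; first exact/diff_derivable/df.
  exact/diff_derivable/dg.
apply: Ck_add => //; apply: IHn => //.
- exact: CkS cf1.
- exact: cg.
- exact: CkS cg1.
- exact: cf.
Qed.

Lemma smooth_near_mul (f g : V -> R^o) x : smooth_near f x -> smooth_near g x ->
  smooth_near (fun y => f y * g y : R^o) x.
Proof.
move=> [A [oA Ax sf]] [B [oB Bx sg]]; exists (A `&` B); split; [exact: openI|by []|].
move=> n; apply: Ck_mul; first exact: openI.
  by apply: CkW (sf n); exact: subIsetl.
by apply: CkW (sg n); exact: subIsetr.
Qed.

(** Only constant vectors are scaled: together with products of scalar functions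
    this reaches every vector-valued map through its coordinates. *)
Lemma Ck_Zl n (W : normedModType R) (U : set V) (f : V -> R^o) (w : W) : open U ->
  Ck n U f -> Ck n U (fun x => f x *: w).
Proof.
move=> oU; elim: n f => [|n IHn] f.
  by move=> cf x Ux; apply: cvgZr_tmp; exact: cf.
move=> -[df cf]; split=> [x Ux|v].
  by apply: (differentiableZl w); exact: df.
apply: (@Ck_eq _ _ _ _ _ (fun x => 'D_v f x *: w)) => //.
  move=> x Ux; have dfx := df x Ux.
  rewrite !deriveE ?diffZl //; exact: differentiableZl.
exact: IHn (cf v).
Qed.

Lemma Ck_coord n m (U : set V) (f : V -> 'rV[R]_m.+1) i : open U -> Ck n U f ->
  Ck n U (fun x => f x 0 i : R^o).
Proof.
move=> oU; elim: n f => [|n IHn] f.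
  move=> cf x Ux.
  apply: (@continuous_comp _ _ _ f (fun M : 'rV[R]_m.+1 => M 0 i)); first exact: cf.
  exact: coord_continuous.
move=> -[df cf]; split=> [x Ux|v].
  apply: (@differentiable_comp _ _ _ _ f (fun M : 'rV[R]_m.+1 => M 0 i : R)).
    exact: df.
  exact: differentiable_coord.
apply: (@Ck_eq _ _ _ _ _ (fun x => 'D_v f x 0 i)) => //; last exact: IHn (cf v).
move=> x Ux; rewrite derive_mx ?mxE //; exact/diff_derivable/df.
Qed.

End Product.

Lemma derive_comp (R : realType) (V V' W : normedModType R) (f : V' -> W)
    (h : V -> V') x v :
  differentiable h x -> differentiable f (h x) ->
  'D_v (f \o h) x = 'D_('D_v h x) f (h x).
Proof.
move=> dh df; rewrite deriveE; last exact: differentiable_comp.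
by rewrite diff_comp //= !deriveE.
Qed.

Section Comp.
Variables (R : realType) (V : normedModType R) (m : nat).

Lemma derive_comp_row (W : normedModType R) (f : 'rV[R]_m.+1 -> W) (h : V -> 'rV[R]_m.+1) x v :
  differentiable h x -> differentiable f (h x) ->
  'D_v (f \o h) x = \sum_i ('D_v h x) 0 i *: 'D_(delta_mx 0 i) f (h x).
Proof.
move=> dh df; rewrite derive_comp // deriveE //.
rewrite {1}[X in 'd f _ X]row_sum_delta linear_sum.
by apply: eq_bigr => i _; rewrite linearZ /= -deriveE.
Qed.

Lemma Ck_sum n (W : normedModType R) (U : set V) (I : Type) (r : seq I) (F : I -> V -> W) :
  open U -> (forall i, Ck n U (F i)) -> Ck n U (fun x => \sum_(i <- r) F i x).
Proof.
move=> oU H; elim: r => [|i r IHr].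
  by under eq_fun do rewrite big_nil; exact: Ck_cst.
by under eq_fun do rewrite big_cons; apply: Ck_add.
Qed.

(** By induction on n: along a vector v the derivative of the composite is the
    sum over i of the i-th coordinate of the derivative of h times the i-th
    partial derivative of f composed with h, whose factors are of class n. *)
Lemma Ck_comp n (U : set V) (U' : set 'rV[R]_m.+1) (f : 'rV[R]_m.+1 -> R^o)
    (h : V -> 'rV[R]_m.+1) : open U -> (forall x, U x -> U' (h x)) ->
  Ck n U' f -> Ck n U h -> Ck n U (f \o h).
Proof.
move=> oU hU; elim: n f => [|n IHn] f.
  move=> cf ch x Ux; apply: continuous_comp; first exact: ch.
  exact/cf/hU.
move=> [df cf] sh; have [dh ch] := sh; split=> [x Ux|v].
  by apply: differentiable_comp; [exact: dh|exact/df/hU].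
apply: (@Ck_eq _ _ _ _ _ (fun x => \sum_i ('D_v h x) 0 i * 'D_(delta_mx 0 i) f (h x))) => //.
  move=> x Ux; rewrite derive_comp_row //; [exact: dh|exact/df/hU].
apply: Ck_sum => // i; apply: Ck_mul => //.
  exact: (Ck_coord i oU (ch v)).
exact: IHn (cf _) (CkS sh).
Qed.

Lemma smooth_near_coord (f : V -> 'rV[R]_m.+1) i x : smooth_near f x ->
  smooth_near (fun y => f y 0 i : R^o) x.
Proof. by move=> [U [oU Ux sf]]; exists U; split=> // n; exact: Ck_coord. Qed.

Lemma smooth_near_row (f : V -> 'rV[R]_m.+1) x :
  (forall i, smooth_near (fun y => f y 0 i : R^o) x) -> smooth_near f x.
Proof.
move=> H.
have -> : f = (fun x => \sum_i (f x 0 i) *: delta_mx 0 i).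
  by apply/funext => y; exact: row_sum_delta.
apply: smooth_near_sum => i; have [U [oU Ux sf]] := H i.
by exists U; split=> // n; exact: Ck_Zl.
Qed.

Lemma smooth_near_comp (f : 'rV[R]_m.+1 -> R^o) (h : V -> 'rV[R]_m.+1) x :
  smooth_near h x -> smooth_near f (h x) -> smooth_near (f \o h) x.
Proof.
move=> [A [oA Ax sh]] [B [oB Bx sf]].
have : nbhs x (h @^-1` B `&` A).
  apply: filterI; last exact: open_nbhs_nbhs.
  apply: (sh 0%N x Ax); exact: open_nbhs_nbhs.
rewrite nbhsE => -[C [oC Cx] CBA]; exists C; split=> // n.
apply: (@Ck_comp n C B) => //; first by move=> y /CBA [].
by apply: CkW (sh n) => y /CBA [].
Qed.

End Comp.

Lemma smooth_near_comp_row (R : realType) (V : normedModType R) m k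
    (f : 'rV[R]_m.+1 -> 'rV[R]_k.+1) (h : V -> 'rV[R]_m.+1) x :
  smooth_near h x -> smooth_near f (h x) -> smooth_near (f \o h) x.
Proof.
move=> sh sf; apply: smooth_near_row => i.
by apply: (@smooth_near_comp _ _ _ (fun z => f z 0 i) h) => //; exact: smooth_near_coord.
Qed.

(** * Symmetry of second derivatives *)

(** The last estimate of second_difference_bound, where a and b are the values
    of a derivative at two nearby points, l its value at the base point, and
    d + t c and d the corresponding linear approximations of the increments. *)
Lemma increment_bound (R : realType) (t a b c d l E1 E2 : R) : 0 < t ->
  `|a - l - (d + t * c)| <= E1 -> `|b - l - d| <= E2 ->
  `|(a - b) * t - t * t * c| <= t * (E1 + E2).
Proof.
move=> t0 H1 H2.
have -> : (a - b) * t - t * t * c = t * ((a - l - (d + t * c)) - (b - l - d)) by ring.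
rewrite normrM gtr0_norm // ler_pM2l //.
exact: le_trans (ler_normB _ _) (lerD H1 H2).
Qed.

Section Schwarz.
Variables (R : realType) (V : normedModType R).
Implicit Types (f : V -> R^o) (x u v : V).

Lemma is_derive_line f x u (s : R) : differentiable f (s *: u + x) ->
  is_derive s 1 (fun s : R => f (s *: u + x)) ('D_u f (s *: u + x)).
Proof.
move=> df.
have dh : differentiable (fun s : R => s *: u + x) s.
  by apply: differentiableD; [exact: differentiableZl|exact: differentiable_cst].
have Dh : 'D_1 (fun s : R => s *: u + x) s = u.
  have -> : (fun s : R => s *: u + x) = ( *:%R^~ u) + cst x by [].
  by rewrite deriveE // diff_val /= !fctE /cst addr0 scale1r.
have dfh := differentiable_comp dh df.
split; first exact/diff_derivable.
by rewrite (@derive_comp R R^o V R^o f (fun s : R => s *: u + x) s 1 dh df) Dh.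
Qed.

Definition second_difference f x u v (t : R) : R :=
  f (t *: u + (t *: v + x)) - f (t *: u + x) - (f (t *: v + x) - f x).

(** The mean value theorem in the direction u turns the second difference into
    t times an increment of the derivative along u; differentiability of that
    derivative at the single point x then suffices to compare the increment
    with t times the iterated derivative. *)
Lemma second_difference_bound f x u v : (\near x, differentiable f x) ->
  differentiable ('D_u f) x -> forall e : R, 0 < e ->
  exists2 d : R, 0 < d & forall t, 0 < t -> t < d ->
   `|second_difference f x u v t - t * t * 'D_v ('D_u f) x| <= e * (t * t).
Proof.
move=> df dg e e0.
(* The two increments used below are at most t (|u| + |v|) and t |u| long; the
   summand 1 keeps k positive when u and v vanish. *)
set k := 2 * `|u| + `|v| + 1.
have k0 : 0 < k by rewrite /k ltr_wpDl // addr_ge0 // mulr_ge0.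
have /diff_locallyP[_ /eqaddoP Eg] := dg.
have ek0 : 0 < e / k by rewrite divr_gt0.
have := Eg _ ek0.
have := df; rewrite (near_shift 0 x) /= => df0 Eg0.
have [r /= r0 Hr] : nbhs_ball (0 : V) [set h | differentiable f (h + (x - 0)) /\
    `|('D_u f \o shift x - (cst ('D_u f x) + 'd ('D_u f) x)) h| <= e / k * `|h|].
  by apply/nbhs_ballP; exact: filterI df0 Eg0.
have {}Hr h : `|h| < r -> differentiable f (h + x) /\
   `|'D_u f (h + x) - 'D_u f x - 'd ('D_u f) x h| <= e / k * `|h|.
  move=> hr; have [] := Hr h; first by rewrite -ball_normE /= sub0r normrN.
  by rewrite /= subr0 => ? H; split=> //; move: H; rewrite !fctE /= opprD addrA.
exists (r / k); first by rewrite divr_gt0.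
move=> t t0 td.
have tk : t * k < r by rewrite -ltr_pdivlMr.
have small s : 0 <= s -> s <= t -> `|s *: u| < r /\ `|s *: u + t *: v| < r.
  move=> s0 st.
  have A : `|s *: u| <= t * `|u| by rewrite normrZ ger0_norm // ler_wpM2r.
  have B : `|t *: v| <= t * `|v| by rewrite normrZ gtr0_norm.
  have C := ler_normD (s *: u) (t *: v).
  have u0 := normr_ge0 u; have v0 := normr_ge0 v.
  have tu := mulr_ge0 (ltW t0) u0; have tv := mulr_ge0 (ltW t0) v0.
  by move: tk; rewrite /k !mulrDr; lra.
pose phi (s : R) : R := f (s *: u + (t *: v + x)) - f (s *: u + x).
pose dphi (s : R) : R := 'D_u f (s *: u + (t *: v + x)) - 'D_u f (s *: u + x).
have Dphi s : 0 <= s -> s <= t -> is_derive s 1 phi (dphi s).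
  move=> s0 st; have [A B] := small s s0 st.
  apply: is_deriveB; apply: is_derive_line.
    by rewrite addrA; exact: (Hr _ B).1.
  exact: (Hr _ A).1.
have [s | | xi xit E] := @MVT R phi dphi 0 t t0.
- by rewrite in_itv /= => /andP[/ltW ? /ltW ?]; exact: Dphi.
- apply: derivable_within_continuous => s; rewrite in_itv /= => /andP[A B].
  by have [] := Dphi s A B.
have := xit; rewrite in_itv /= => /andP[/ltW x0 /ltW xt].
have [A B] := small xi x0 xt.
have [_ HA] := Hr _ A; have [_ HB] := Hr _ B.
have -> : second_difference f x u v t = phi t - phi 0.
  by rewrite /second_difference /phi !scale0r !add0r.
have Ev : 'D_v ('D_u f) x = 'd ('D_u f) x v by rewrite deriveE.
rewrite E subr0 /dphi addrA Ev.
have EB : 'd ('D_u f) x (xi *: u + t *: v) = 'd ('D_u f) x (xi *: u) + t * 'd ('D_u f) x v.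
  by rewrite linearD [in RHS]/= [X in _ + X]linearZ.
rewrite EB in HB.
apply: le_trans (increment_bound t0 HB HA) _.
rewrite mulrCA ler_pM2l // -mulrDr -mulrA ler_pM2l // ler_pdivrMl //.
have A1 : `|xi *: u| <= t * `|u| by rewrite normrZ ger0_norm // ler_wpM2r.
have B1 : `|t *: v| <= t * `|v| by rewrite normrZ gtr0_norm.
have C1 := ler_normD (xi *: u) (t *: v).
have := mulr_ge0 (ltW t0) (normr_ge0 u); have := mulr_ge0 (ltW t0) (normr_ge0 v).
rewrite /k; lra.
Qed.

(** The second difference is symmetric in u and v, so both iterated derivatives
    are limits of the same quotient. *)
Lemma derive_comm f x u v : (\near x, differentiable f x) ->
  differentiable ('D_u f) x -> differentiable ('D_v f) x ->
  'D_v ('D_u f) x = 'D_u ('D_v f) x.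
Proof.
move=> df du dv; apply/eqP; rewrite -subr_eq0 -normr_le0.
apply/ler_addgt0Pr => e e0; rewrite add0r.
have e20 : 0 < e / 2 by rewrite divr_gt0.
have [d1 d10 H1] := second_difference_bound v df du e20.
have [d2 d20 H2] := second_difference_bound u df dv e20.
pose t := Num.min d1 d2 / 2.
have m0 : 0 < Num.min d1 d2 by rewrite lt_min d10.
have t0 : 0 < t by rewrite divr_gt0.
have tm : t < Num.min d1 d2 by rewrite /t; lra.
have [t1 t2] : t < d1 /\ t < d2 by move: tm; rewrite lt_min => /andP.
have {}H1 := H1 t t0 t1; have {}H2 := H2 t t0 t2.
have S : second_difference f x v u t = second_difference f x u v t.
  by rewrite /second_difference addrCA; ring.
rewrite S in H2; have tt : 0 < t * t by rewrite mulr_gt0.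
rewrite -(ler_pM2l tt) -[X in X * `|_|]gtr0_norm // -normrM.
set a := 'D_v _ x in H1 *; set b := 'D_u _ x in H2 *.
set D := second_difference _ _ _ _ _ in H1 H2.
have -> : t * t * (a - b) = (D - t * t * b) - (D - t * t * a) by ring.
apply: le_trans (ler_normB _ _) _; apply: le_trans (lerD H2 H1) _.
by rewrite -mulrDl -splitr mulrC.
Qed.

End Schwarz.

Section SmoothComm.
Variables (R : realType) (V : normedModType R).

Lemma smooth_near_derive_comm (f : V -> R^o) x u v : smooth_near f x ->
  'D_v ('D_u f) x = 'D_u ('D_v f) x.
Proof.
move=> sf; apply: derive_comm.
- exact: smooth_near_diff_near.
- exact/smooth_near_diff/smooth_near_derive.
- exact/smooth_near_diff/smooth_near_derive.
Qed.

Lemma derive_coord m (f : V -> 'rV[R]_m.+1) x v i : differentiable f x ->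
  'D_v f x 0 i = 'D_v (fun y => f y 0 i : R^o) x.
Proof. by move=> df; rewrite derive_mx ?mxE //; exact: diff_derivable. Qed.

Lemma smooth_near_derive_comm_row m (f : V -> 'rV[R]_m.+1) x u v :
  smooth_near f x -> 'D_v ('D_u f) x = 'D_u ('D_v f) x.
Proof.
move=> sf; apply/rowP => i.
have H a b : 'D_a ('D_b f) x 0 i = 'D_a ('D_b (fun y => f y 0 i : R^o)) x.
  rewrite derive_coord; last exact/smooth_near_diff/smooth_near_derive.
  apply: near_eq_derive. apply: filterS (smooth_near_diff_near sf) => y dfy.
  exact: derive_coord.
have [E1 E2] := (H v u, H u v); refine (etrans E1 (etrans _ (esym E2))).
by apply: smooth_near_derive_comm; exact: smooth_near_coord.
Qed.

End SmoothComm.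

(** * Smooth functions and fields in charts *)

Section Charts.
Variables (R : realType) (M : manifold3 R).
Implicit Types (c d e : chart R M) (p q : M) (X Y : vfield M).

(** A neighbourhood of p in the manifold is seen in the chart as a neighbourhood of
    the coordinates of p on which cinv is the honest inverse of cmap. *)
Lemma near_cinv c p (N : set M) : cdom c p -> nbhs p N ->
  \forall y \near cmap c p,
    [/\ cdom c (cinv c y), cmap c (cinv c y) = y & N (cinv c y)].
Proof.
move=> cp Np; have img : (cmap c @` cdom c) (cmap c p) by exists p.
have N1 : \forall y \near cmap c p, N (cinv c y).
  by apply: (cinv_continuous img); rewrite cmapK.
have N2 := open_nbhs_nbhs (conj (@cimg_open _ _ c) img).
apply: filterS2 N1 N2 => y Ny [q cq qy].
by rewrite -qy cmapK // in Ny *.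
Qed.

Lemma near_cmap c p (W : set 'rV[R]_3) : cdom c p -> nbhs (cmap c p) W ->
  \forall q \near p, cdom c q /\ W (cmap c q).
Proof.
move=> cp Wp; apply: filterI; last exact: (cmap_continuous cp).
exact: open_nbhs_nbhs (conj (@cdom_open _ _ c) cp).
Qed.

Lemma near_cdom c p : cdom c p -> nbhs p (cdom c).
Proof. by move=> cp; exact: open_nbhs_nbhs (conj (@cdom_open _ _ c) cp). Qed.

Lemma transition_cmap c d p : cdom c p -> transition c d (cmap c p) = cmap d p.
Proof. by move=> cp; rewrite /transition /= cmapK. Qed.

Lemma compatible_smooth c d p : compatible c d -> cdom c p -> cdom d p ->
  smooth_near (transition c d) (cmap c p).
Proof.
move=> [cd _] cp dp.
have : \forall y \near cmap c p, (cmap c @` (cdom c `&` cdom d)) y.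
  apply: filterS (near_cinv cp (near_cdom dp)) => y [? ? ?].
  by exists (cinv c y).
move=> /near_ex_open [U [oU Up HU]]; exists U; split=> //.
exact: smooth_onW HU cd.
Qed.

Lemma compatible_sym c d : compatible c d -> compatible d c.
Proof.
by rewrite /compatible setIC => -[H1 H2]; split.
Qed.

Lemma smooth_chart_at p : smooth_chart (chart_at p).
Proof. by move=> q; exact: chart_at_compatible. Qed.

Lemma near_transition_comp c d e p : cdom c p -> cdom d p ->
  \forall y \near cmap c p, (transition d e \o transition c d) y = transition c e y.
Proof.
move=> cp dp; apply: filterS (near_cinv cp (near_cdom dp)) => y [cy yE dy].
by rewrite /transition /= cmapK.
Qed.

(** Members of the maximal atlas are compatible with the preferred charts by
    definition; with each other, because near p their transition factors through
    chart_at p. *)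
Lemma transition_smooth c d p : smooth_chart c -> smooth_chart d ->
  cdom c p -> cdom d p -> smooth_near (transition c d) (cmap c p).
Proof.
move=> sc sd cp dp; have ep := chart_at_dom p.
apply: smooth_near_eq (near_transition_comp d cp ep) _.
apply: smooth_near_comp_row; first exact: compatible_smooth.
rewrite transition_cmap //; apply: compatible_smooth => //.
exact: compatible_sym.
Qed.

Lemma transition_diff c d p : smooth_chart c -> smooth_chart d ->
  cdom c p -> cdom d p -> differentiable (transition c d) (cmap c p).
Proof. by move=> *; apply: smooth_near_diff; exact: transition_smooth. Qed.

(** The chain rule. *)
Lemma tangent_change_trans c d e p u : 
  smooth_chart c -> smooth_chart d -> smooth_chart e ->
  cdom c p -> cdom d p -> cdom e p ->
  tangent_change d e p (tangent_change c d p u) = tangent_change c e p u.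
Proof.
move=> sc sd se cp dp ep; rewrite /tangent_change.
rewrite -(near_eq_derive u (near_transition_comp e cp dp)).
rewrite derive_comp ?transition_cmap //; exact: transition_diff.
Qed.

Lemma tangent_change_id c p u : cdom c p -> tangent_change c c p u = u.
Proof.
move=> cp; rewrite /tangent_change.
have : \forall y \near cmap c p, transition c c y = id y.
  by apply: filterS (near_cinv cp (near_cdom cp)) => y [].
by move=> /(near_eq_derive u) ->; rewrite derive_id.
Qed.

Lemma tangent_changeP c d p a u v : smooth_chart c -> smooth_chart d ->
  cdom c p -> cdom d p -> tangent_change c d p (a *: u + v) =
    a *: tangent_change c d p u + tangent_change c d p v.
Proof.
move=> sc sd cp dp; have df := transition_diff sc sd cp dp.
have E w : tangent_change c d p w = 'd (transition c d) (cmap c p) w by exact: deriveE.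
by rewrite (E (_ + _)) (E u) (E v) linearP.
Qed.

Lemma tangent_change0 c d p : tangent_change c d p 0 = 0.
Proof. exact: derive0. Qed.

Lemma components_cmap c X p : cdom c p ->
  components c X (cmap c p) = tangent_change (chart_at p) c p (X p).
Proof. by move=> cp; rewrite /components cmapK. Qed.

Lemma components_change c d X p : smooth_chart c -> smooth_chart d ->
  cdom c p -> cdom d p ->
  components d X (cmap d p) = tangent_change c d p (components c X (cmap c p)).
Proof.
move=> sc sd cp dp; rewrite (components_cmap X dp) (components_cmap X cp).
rewrite tangent_change_trans //.
- exact: smooth_chart_at.
- exact: chart_at_dom.
Qed.

Lemma components_chart_at X p : components (chart_at p) X (cmap (chart_at p) p) = X p.
Proof.
have ep := chart_at_dom p.
by rewrite components_cmap // tangent_change_id.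
Qed.

Lemma value_components c X p : smooth_chart c -> cdom c p ->
  X p = tangent_change c (chart_at p) p (components c X (cmap c p)).
Proof.
move=> sc cp; rewrite -components_change ?components_chart_at //.
- exact: smooth_chart_at.
- exact: chart_at_dom.
Qed.

(** In coordinates, components transform by the Jacobian matrix of the transition
    map, whose entries are smooth. *)
Lemma smooth_components_change c d X p : smooth_chart c -> smooth_chart d ->
  cdom c p -> cdom d p -> smooth_near (components c X) (cmap c p) ->
  smooth_near (components d X) (cmap d p).
Proof.
move=> sc sd cp dp sX.
have sphi := transition_smooth sc sd cp dp.
have spsi := transition_smooth sd sc dp cp.
pose F y : 'rV[R]_3 := \sum_i (components c X y) 0 i *: 'D_(delta_mx 0 i) (transition c d) y.
apply: (@smooth_near_eq _ _ _ (F \o transition d c)).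
  apply: filterS (near_cinv dp (near_cdom cp)) => y [dy yE cy].
  rewrite -{2}yE (components_change X sc sd cy dy) /F /tangent_change.
  rewrite /transition /= -!/(transition _ _).
  have df := transition_diff sc sd cy dy.
  rewrite [RHS]deriveE // [X in 'd _ _ X]row_sum_delta linear_sum.
  by apply: eq_bigr => i _; rewrite linearZ /= deriveE.
apply: smooth_near_comp_row => //; rewrite transition_cmap //.
apply: smooth_near_row => j.
rewrite /F; under eq_fun do rewrite summxE.
apply: smooth_near_sum => i; under eq_fun do rewrite mxE.
apply: smooth_near_mul; first exact: smooth_near_coord.
by apply: smooth_near_coord; exact: smooth_near_derive.
Qed.

Lemma smooth_vfield_atP c X p : smooth_chart c -> cdom c p ->
  smooth_vfield_at X p <-> smooth_near (components c X) (cmap c p).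
Proof.
move=> sc cp; have ep := chart_at_dom p; have se := @smooth_chart_at p.
by split; apply: smooth_components_change.
Qed.

Lemma smooth_fun_change c d (f : M -> R) p : smooth_chart c -> smooth_chart d ->
  cdom c p -> cdom d p ->
  smooth_near (f \o cinv c : 'rV[R]_3 -> R^o) (cmap c p) ->
  smooth_near (f \o cinv d : 'rV[R]_3 -> R^o) (cmap d p).
Proof.
move=> sc sd cp dp sf.
apply: (@smooth_near_eq _ _ _ ((f \o cinv c) \o transition d c)).
  apply: filterS (near_cinv dp (near_cdom cp)) => y [dy yE cy].
  by rewrite /transition /= cmapK.
apply: smooth_near_comp; first exact: transition_smooth.
by rewrite transition_cmap.
Qed.

Lemma smooth_fun_atP c f p : smooth_chart c -> cdom c p ->
  smooth_fun_at f p <-> smooth_near (f \o cinv c : 'rV[R]_3 -> R^o) (cmap c p).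
Proof.
move=> sc cp; have ep := chart_at_dom p; have se := @smooth_chart_at p.
by split; apply: smooth_fun_change.
Qed.

Lemma smooth_fun_at_near f p : smooth_fun_at f p -> \forall q \near p, smooth_fun_at f q.
Proof.
move=> /smooth_near_near H; apply: filterS (near_cmap (chart_at_dom p) H) => q [cq sf].
exact/(smooth_fun_atP f (@smooth_chart_at p) cq).
Qed.

Lemma smooth_vfield_at_near X p : smooth_vfield_at X p ->
  \forall q \near p, smooth_vfield_at X q.
Proof.
move=> /smooth_near_near H; apply: filterS (near_cmap (chart_at_dom p) H) => q [cq sf].
exact/(smooth_vfield_atP X (@smooth_chart_at p) cq).
Qed.

Lemma near_chart_eq (T : Type) c p (f f' : M -> T) : cdom c p ->
  (\forall q \near p, f q = f' q) -> \forall y \near cmap c p, f (cinv c y) = f' (cinv c y).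
Proof. by move=> cp H; apply: filterS (near_cinv cp H) => y []. Qed.

Lemma smooth_fun_at_eq (f f' : M -> R) p : (\forall q \near p, f q = f' q) ->
  smooth_fun_at f p -> smooth_fun_at f' p.
Proof. by move=> H; apply: smooth_near_eq; exact: near_chart_eq (chart_at_dom p) H. Qed.

Lemma smooth_vfield_at_eq X Y p : (\forall q \near p, X q = Y q) ->
  smooth_vfield_at X p -> smooth_vfield_at Y p.
Proof.
move=> H; apply: smooth_near_eq.
by apply: filterS (near_chart_eq (chart_at_dom p) H) => y E; rewrite /components E.
Qed.

Lemma vderive_eq X (f f' : M -> R) p : (\forall q \near p, f q = f' q) ->
  vderive X f p = vderive X f' p.
Proof.
by move=> H; apply: near_eq_derive; exact: near_chart_eq (chart_at_dom p) H.
Qed.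

(** The derivative of a function along a field is defined in the preferred chart
    at each point; it can be computed in any other one. *)
Lemma vderiveE c X f p : smooth_chart c -> cdom c p -> smooth_fun_at f p ->
  vderive X f p =
  'D_(components c X (cmap c p)) (f \o cinv c : 'rV[R]_3 -> R^o) (cmap c p).
Proof.
move=> sc cp sf; have ep := chart_at_dom p; have se := @smooth_chart_at p.
have /(smooth_fun_atP f sc cp) /smooth_near_diff dfc := sf.
rewrite /vderive.
set g := (f \o cinv c : 'rV[R]_3 -> R^o).
have E : \forall y \near cmap (chart_at p) p,
    (f \o cinv (chart_at p) : 'rV[R]_3 -> R^o) y = (g \o transition (chart_at p) c) y.
  apply: filterS (near_cinv ep (near_cdom cp)) => y [ey yE cy].
  by rewrite /g /transition /= cmapK.
refine (etrans (near_eq_derive _ E) _).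
have gE : differentiable g (transition (chart_at p) c (cmap (chart_at p) p)).
  by rewrite transition_cmap.
refine (etrans (derive_comp (X p) (transition_diff se sc ep cp) gE) _).
by rewrite (transition_cmap c ep) (components_cmap X cp).
Qed.

Lemma smooth_fun_cst a p : smooth_fun_at (fun _ : M => a) p.
Proof. exact: smooth_near_cst. Qed.

Lemma smooth_funD (f f' : M -> R) p : smooth_fun_at f p -> smooth_fun_at f' p ->
  smooth_fun_at (fun q => f q + f' q) p.
Proof. exact: smooth_near_add. Qed.

Lemma smooth_funM (f f' : M -> R) p : smooth_fun_at f p -> smooth_fun_at f' p ->
  smooth_fun_at (fun q => f q * f' q) p.
Proof. exact: smooth_near_mul. Qed.

Lemma vderiveD X (f f' : M -> R) p : smooth_fun_at f p -> smooth_fun_at f' p ->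
  vderive X (fun q => f q + f' q) p = vderive X f p + vderive X f' p.
Proof.
move=> /smooth_near_diff sf /smooth_near_diff sf'.
by rewrite /vderive -deriveD //; exact: diff_derivable.
Qed.

Lemma vderiveMl X a (f : M -> R) p : smooth_fun_at f p ->
  vderive X (fun q => a * f q) p = a * vderive X f p.
Proof.
move=> /smooth_near_diff sf.
by rewrite /vderive -[RHS]deriveZ //; exact: diff_derivable.
Qed.

Lemma smooth_vfieldD X Y p : smooth_vfield_at X p -> smooth_vfield_at Y p ->
  smooth_vfield_at (fun q => X q + Y q) p.
Proof.
move=> sX sY; apply: smooth_near_eq (smooth_near_add sX sY).
have ep := chart_at_dom p; have se := @smooth_chart_at p.
apply: filterS (near_cinv ep (near_cdom ep)) => y [ey yE _].
have sq := @smooth_chart_at (cinv (chart_at p) y).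
have := tangent_changeP 1 (X (cinv (chart_at p) y)) (Y (cinv (chart_at p) y)) 
  sq se (chart_at_dom _) ey.
by rewrite !scale1r /components => ->.
Qed.

Lemma smooth_vfieldZ (f : M -> R) X p : smooth_fun_at f p -> smooth_vfield_at X p ->
  smooth_vfield_at (fun q => f q *: X q) p.
Proof.
have ep := chart_at_dom p; have se := @smooth_chart_at p.
move=> sf sX; apply: (@smooth_near_eq _ _ _ 
  (fun y => f (cinv (chart_at p) y) *: components (chart_at p) X y)).
  apply: filterS (near_cinv ep (near_cdom ep)) => y [ey yE _].
  have sq := @smooth_chart_at (cinv (chart_at p) y).
  have := tangent_changeP (f (cinv (chart_at p) y)) (X (cinv (chart_at p) y)) 0
    sq se (chart_at_dom _) ey.
  by rewrite (tangent_change0 _ _ _) !addr0 /components => ->.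
apply: smooth_near_row => i; under eq_fun do rewrite mxE.
by apply: smooth_near_mul => //; exact: smooth_near_coord.
Qed.

Definition const_field c (w : 'rV[R]_3) : vfield M :=
  fun p => tangent_change c (chart_at p) p w.

Lemma components_const c w p : smooth_chart c -> cdom c p ->
  components c (const_field c w) (cmap c p) = w.
Proof.
move=> sc cp; have ep := chart_at_dom p; have se := @smooth_chart_at p.
by rewrite components_cmap // tangent_change_trans // tangent_change_id.
Qed.

Lemma smooth_const_field c w p : smooth_chart c -> cdom c p ->
  smooth_vfield_at (const_field c w) p.
Proof.
move=> sc cp; apply/(smooth_vfield_atP _ sc cp).
apply: smooth_near_eq (smooth_near_cst w _).
by apply: filterS (near_cinv cp (near_cdom cp)) => y [cy <- _]; rewrite components_const.
Qed.

Lemma const_fieldP c a u v p : smooth_chart c -> cdom c p ->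
  const_field c (a *: u + v) p = a *: const_field c u p + const_field c v p.
Proof.
by move=> sc cp; apply: tangent_changeP => //; [exact: smooth_chart_at|exact: chart_at_dom].
Qed.

(** In the preferred chart at p, the field with constant components v is the
    derivative of the transition map along v; the bracket is therefore the
    difference of two mixed second derivatives of the transition map. *)
Lemma lie_bracket_const c u v p : smooth_chart c -> cdom c p ->
  lie_bracket (const_field c u) (const_field c v) p = 0.
Proof.
move=> sc cp; have ep := chart_at_dom p; have se := @smooth_chart_at p.
have sphi := transition_smooth sc se cp ep.
have dpsi := transition_diff se sc ep cp.
have H a b : 'D_(const_field c a p) (components (chart_at p) (const_field c b))
    (cmap (chart_at p) p) = 'D_a ('D_b (transition c (chart_at p))) (cmap c p).
  have E : \forall y \near cmap (chart_at p) p, 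
    components (chart_at p) (const_field c b) y =
      ('D_b (transition c (chart_at p)) \o transition (chart_at p) c) y.
    apply: filterS (near_cinv ep (near_cdom cp)) => y [ey yE cy].
    rewrite -{1}yE (components_change _ sc se cy ey) components_const //.
  refine (etrans (near_eq_derive _ E) _).
  have dD : differentiable ('D_b (transition c (chart_at p)))
     (transition (chart_at p) c (cmap (chart_at p) p)).
    by rewrite transition_cmap //; exact/smooth_near_diff/smooth_near_derive.
  refine (etrans (derive_comp (const_field c a p) dpsi dD) _).
  rewrite (transition_cmap c ep); congr ('D_ _ _ _).
  rewrite -[LHS]/(tangent_change (chart_at p) c p (tangent_change c (chart_at p) p a)).
  by rewrite tangent_change_trans // tangent_change_id.
have [E1 E2] := (H u v, H v u); rewrite /lie_bracket; apply/eqP; rewrite subr_eq0; apply/eqP.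
refine (etrans E1 (etrans _ (esym E2))); exact: smooth_near_derive_comm_row.
Qed.

(** The coefficients of a field in the coordinate basis, as functions on the
    manifold: this is what allows tensoriality to be used. *)
Lemma near_vfield_expansion c X p : smooth_chart c -> cdom c p ->
  \forall q \near p, X q = 
   \sum_i (components c X (cmap c q)) 0 i *: const_field c (delta_mx 0 i) q.
Proof.
move=> sc cp; apply: filterS (near_cdom cp) => q cq.
rewrite (value_components X sc cq) {1}[components _ _ _]row_sum_delta.
have eq := chart_at_dom q; have se := @smooth_chart_at q.
rewrite /tangent_change deriveE; last exact: transition_diff.
rewrite linear_sum; apply: eq_bigr => i _; rewrite linearZ /=.
by rewrite -deriveE //; exact: transition_diff.
Qed.

Lemma smooth_components_fun c X p i : smooth_chart c -> cdom c p ->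
  smooth_vfield_at X p ->
  smooth_fun_at (fun q => (components c X (cmap c q)) 0 i) p.
Proof.
move=> sc cp /(smooth_vfield_atP X sc cp) sX; apply/(smooth_fun_atP _ sc cp).
apply: smooth_near_eq (smooth_near_coord i sX).
by apply: filterS (near_cinv cp (near_cdom cp)) => y [cy yE _]; rewrite /= yE.
Qed.

Lemma vderive_const c w f p : smooth_chart c -> cdom c p -> smooth_fun_at f p ->
  vderive (const_field c w) f p = 'D_w (f \o cinv c : 'rV[R]_3 -> R^o) (cmap c p).
Proof. by move=> sc cp sf; rewrite (vderiveE _ sc cp sf) components_const. Qed.

Lemma near_vderive_const c w f p : smooth_chart c -> cdom c p -> smooth_fun_at f p ->
  \forall y \near cmap c p, (vderive (const_field c w) f \o cinv c) y =
    'D_w (f \o cinv c : 'rV[R]_3 -> R^o) y.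
Proof.
move=> sc cp sf; apply: filterS (near_cinv cp (smooth_fun_at_near sf)).
by move=> y [cy yE sfy]; rewrite /= (vderive_const w sc cy sfy) yE.
Qed.

Lemma smooth_vderive_const c w f p : smooth_chart c -> cdom c p -> smooth_fun_at f p ->
  smooth_fun_at (vderive (const_field c w) f) p.
Proof.
move=> sc cp sf; apply/(smooth_fun_atP _ sc cp).
have H := near_vderive_const w sc cp sf.
apply: (@smooth_near_eq _ _ _ ('D_w (f \o cinv c : 'rV[R]_3 -> R^o))).
  by apply: filterS H => y ->.
by apply: smooth_near_derive; apply/(smooth_fun_atP _ sc cp).
Qed.

Lemma vderive_const_comm c u v f p : smooth_chart c -> cdom c p -> smooth_fun_at f p ->
  vderive (const_field c u) (vderive (const_field c v) f) p =
  vderive (const_field c v) (vderive (const_field c u) f) p.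
Proof.
move=> sc cp sf.
have H a b : vderive (const_field c a) (vderive (const_field c b) f) p =
   'D_a ('D_b (f \o cinv c : 'rV[R]_3 -> R^o)) (cmap c p).
  refine (etrans (vderive_const a sc cp (smooth_vderive_const b sc cp sf)) _).
  by apply: near_eq_derive; exact: near_vderive_const.
have [E1 E2] := (H u v, H v u); refine (etrans E1 (etrans _ (esym E2))).
by apply: smooth_near_derive_comm; apply/(smooth_fun_atP _ sc cp).
Qed.

End Charts.

(** * Locality and tensoriality of the curvature *)

Section Vderive.
Variables (R : realType) (M : manifold3 R).
Implicit Types (p : M) (X Y Z : vfield M) (f : M -> R).

Lemma smooth_vderive X f p : smooth_vfield_at X p -> smooth_fun_at f p ->
  smooth_fun_at (vderive X f) p.
Proof.
move=> sX sf; have ep := chart_at_dom p; have se := @smooth_chart_at _ _ p.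
have sfc : smooth_near (f \o cinv (chart_at p) : 'rV[R]_3 -> R^o) (cmap (chart_at p) p) by [].
apply: (@smooth_near_eq _ _ _ (fun y => \sum_i components (chart_at p) X y 0 i *
   'D_(delta_mx 0 i) (f \o cinv (chart_at p) : 'rV[R]_3 -> R^o) y : R^o)).
  have H := near_cinv ep (smooth_fun_at_near sf).
  apply: filterS2 H (smooth_near_diff_near sfc) => y [ey yE sfy] dfy.
  symmetry; refine (etrans (vderiveE X se ey sfy) _).
  rewrite yE deriveE // [X in 'd _ _ X]row_sum_delta linear_sum.
  by apply: eq_bigr => i _; rewrite linearZ /= deriveE.
apply: smooth_near_sum => i; apply: smooth_near_mul; first exact: smooth_near_coord.
exact: smooth_near_derive.
Qed.

Lemma vderive_cst X (a : R) p : vderive X (fun _ => a) p = 0.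
Proof. exact: derive_cst. Qed.

Lemma smooth_vfield0 p : smooth_vfield_at (fun _ : M => 0) p.
Proof.
apply: smooth_near_eq (smooth_near_cst 0 _); apply: filterE => y.
by rewrite /components tangent_change0.
Qed.

Lemma smooth_vfieldB X Y p : smooth_vfield_at X p -> smooth_vfield_at Y p ->
  smooth_vfield_at (fun q => X q - Y q) p.
Proof.
move=> sX sY.
have -> : (fun q => X q - Y q) = (fun q => X q + (fun q => (-1) *: Y q) q).
  by apply/funext => q; rewrite scaleN1r.
exact: smooth_vfieldD sX (smooth_vfieldZ (smooth_fun_cst _ _) sY).
Qed.

(** Smoothness at p only constrains a function near p, so the indicator function
    of any neighbourhood of p is smooth at p; it serves as a bump function. *)
Definition indicator (P : set M) : M -> R := fun q => (`[< P q >])%:R.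

Lemma smooth_indicator P p : nbhs p P -> smooth_fun_at (indicator P) p.
Proof.
move=> nP; apply: smooth_fun_at_eq (smooth_fun_cst 1 p).
by apply: filterS nP => q Pq; rewrite /indicator; case: asboolP.
Qed.

Lemma indicator1 P p : nbhs p P -> indicator P p = 1.
Proof. by move=> /nbhs_singleton Pp; rewrite /indicator; case: asboolP. Qed.

Lemma vderive_indicator X P p : nbhs p P -> vderive X (indicator P) p = 0.
Proof.
move=> nP; rewrite -(vderive_cst X 1 p); apply: vderive_eq.
by apply: filterS nP => q Pq; rewrite /indicator; case: asboolP.
Qed.

(** Two fields become globally equal once multiplied by the indicator of the set
    where they agree. *)
Lemma indicatorZ X Y :
  (fun q => indicator [set q | X q = Y q] q *: X q) =
  (fun q => indicator [set q | X q = Y q] q *: Y q).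
Proof.
by apply/funext => q; rewrite /indicator; case: asboolP => [->|]; rewrite ?scale0r.
Qed.

(** Linearity over the functions smooth at p, for an operator whose result is a
    value at p. *)
Definition tensorial_at p (W : lmodType R) (T : vfield M -> W) : Prop :=
  (forall X Y, smooth_vfield_at X p -> smooth_vfield_at Y p ->
     T (fun q => X q + Y q) = T X + T Y) /\
  (forall f X, smooth_fun_at f p -> smooth_vfield_at X p ->
     T (fun q => f q *: X q) = f p *: T X).

Section Tensorial.
Variables (p : M) (W : lmodType R) (T : vfield M -> W).
Hypothesis HT : tensorial_at p T.

(** Multiplying both fields by the indicator of the set where they agree does not
    change the values of T. *)
Lemma tensorial_near X Y : smooth_vfield_at X p -> (\forall q \near p, X q = Y q) ->
  T X = T Y.
Proof.
move=> sX E; have sY := smooth_vfield_at_eq E sX.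
have [_ H] := HT; set P := [set q | X q = Y q].
have sP := smooth_indicator E; have E1 := indicator1 E.
have := H _ _ sP sX; rewrite indicatorZ (H _ _ sP sY) E1 !scale1r.
by move=> ->.
Qed.

Lemma tensorial0 : T (fun _ => 0) = 0.
Proof.
have [_ H] := HT.
have := H (fun _ => 0) (fun _ => 0) (smooth_fun_cst 0 p) (smooth_vfield0 p).
by rewrite !scale0r.
Qed.

Lemma tensorial_sum n (F : 'I_n -> vfield M) : (forall i, smooth_vfield_at (F i) p) ->
  smooth_vfield_at (fun q => \sum_i F i q) p /\
  T (fun q => \sum_i F i q) = \sum_i T (F i).
Proof.
move=> sF; elim: (index_enum _) => [|i r [IH1 IH2]].
  under eq_fun do rewrite big_nil; rewrite big_nil; split; first exact: smooth_vfield0.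
  exact: tensorial0.
under eq_fun do rewrite big_cons; rewrite big_cons -IH2; split.
  exact: smooth_vfieldD (sF i) IH1.
exact: HT.1 _ _ (sF i) IH1.
Qed.

(** A tensorial operator depends only on the value of the field at p. *)
Lemma tensorial_expansion X : smooth_vfield_at X p ->
  T X = \sum_i (X p) 0 i *: T (const_field (chart_at p) (delta_mx 0 i)).
Proof.
move=> sX; have ep := chart_at_dom p; have se := @smooth_chart_at _ _ p.
have sE i := smooth_const_field (delta_mx 0 i) se ep.
have sc i := smooth_components_fun i se ep sX.
have sF i : smooth_vfield_at (fun q => components (chart_at p) X (cmap (chart_at p) q) 0 i *:
   const_field (chart_at p) (delta_mx 0 i) q) p := smooth_vfieldZ (sc i) (sE i).
rewrite (tensorial_near sX (near_vfield_expansion X se ep)) (tensorial_sum sF).2.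
apply: eq_bigr => i _; rewrite (HT.2 _ _ (sc i) (sE i)).
by rewrite components_chart_at.
Qed.

End Tensorial.

Lemma tensorial_ext p (W : lmodType R) (T T' : vfield M -> W) :
  (forall X, smooth_vfield_at X p -> T X = T' X) -> tensorial_at p T -> tensorial_at p T'.
Proof.
move=> E [H1 H2]; split=> [X Y sX sY|f X sf sX].
  by rewrite -(E _ sX) -(E _ sY) -E; [exact: H1 _ _ sX sY|exact: smooth_vfieldD sX sY].
by rewrite -(E _ sX) -E; [exact: H2 _ _ sf sX|exact: smooth_vfieldZ sf sX].
Qed.

Lemma tensorial_add p (W : lmodType R) (T T' : vfield M -> W) :
  tensorial_at p T -> tensorial_at p T' -> tensorial_at p (fun X => T X + T' X).
Proof.
move=> [H1 H2] [H1' H2']; split=> [X Y sX sY|f X sf sX].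
  by rewrite (H1 _ _ sX sY) (H1' _ _ sX sY) addrACA.
by rewrite (H2 _ _ sf sX) (H2' _ _ sf sX) scalerDr.
Qed.

Lemma tensorial_scale p (W : lmodType R) (a : R) (T : vfield M -> W) :
  tensorial_at p T -> tensorial_at p (fun X => a *: T X).
Proof.
move=> [H1 H2]; split=> [X Y sX sY|f X sf sX].
  by rewrite (H1 _ _ sX sY) scalerDr.
by rewrite (H2 _ _ sf sX) !scalerA mulrC.
Qed.

Lemma tensorial_bigsum p (W : lmodType R) (I : Type) (r : seq I) (T : I -> vfield M -> W) :
  (forall i, tensorial_at p (T i)) -> tensorial_at p (fun X => \sum_(i <- r) T i X).
Proof.
move=> H; elim: r => [|i r IHr].
  by split=> *; rewrite !big_nil ?addr0 ?scaler0.
apply: tensorial_ext (tensorial_add (H i) IHr) => X _; by rewrite big_cons.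
Qed.

Lemma tensorial_value p (L : 'rV[R]_3 -> R) : scalar L ->
  @tensorial_at p R^o (fun X => L (X p)).
Proof.
move=> HL; split=> [X Y _ _|f X _ _].
  by rewrite -[X p in LHS]scale1r HL mul1r.
have L0 : L 0 = 0 by have := HL (-1) 0 0; rewrite scaler0 addr0 mulN1r addNr.
by rewrite -[_ *: X p]addr0 HL L0 addr0.
Qed.

Lemma tensorial_lcomp p (W : lmodType R) (T : vfield M -> W) (L : W -> R) : scalar L ->
  tensorial_at p T -> @tensorial_at p R^o (fun X => L (T X)).
Proof.
move=> HL [H1 H2]; split=> [X Y sX sY|f X sf sX].
  by rewrite (H1 _ _ sX sY) -[T X in LHS]scale1r HL mul1r.
have L0 : L 0 = 0 by have := HL (-1) 0 0; rewrite scaler0 addr0 mulN1r addNr.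
by rewrite (H2 _ _ sf sX) -[_ *: T X]addr0 HL L0 addr0.
Qed.

Section Connection.
Variable nabla : connection M.
Hypothesis Hn : affine_connection nabla.

Lemma nabla_tensorial Y p : smooth_vfield_at Y p ->
  tensorial_at p (fun X => nabla X Y p).
Proof.
move=> sY; split=> [X1 X2 s1 s2|f X sf sX]; first exact: (conn_addl Hn s1 s2 sY).
exact: (conn_scalel Hn sf sX sY).
Qed.

(** The derivative of the indicator vanishes at p, so the Leibniz rule for it
    reduces to locality. *)
Lemma nabla_near X Y Y' p : smooth_vfield_at X p -> smooth_vfield_at Y p ->
  (\forall q \near p, Y q = Y' q) -> nabla X Y p = nabla X Y' p.
Proof.
move=> sX sY E; have sY' := smooth_vfield_at_eq E sY.
have sP := smooth_indicator E; have E1 := indicator1 E.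
have := conn_leibniz Hn sP sX sY; rewrite indicatorZ (conn_leibniz Hn sP sX sY').
by rewrite (vderive_indicator X E) E1 !scale0r !add0r !scale1r => ->.
Qed.

End Connection.

Section LeviCivita.
Variables (h : formfield M) (nabla : connection M).
Hypothesis Hlc : levi_civita h nabla.
Let Hn := lc_affine Hlc.

(** This identity gives access to the bracket of arbitrary fields through the
    axioms of a connection, without computing it in coordinates. *)
Lemma near_torsion X Y p : smooth_vfield_at X p -> smooth_vfield_at Y p ->
  \forall q \near p, nabla X Y q - nabla Y X q = lie_bracket X Y q.
Proof.
move=> sX sY.
apply: filterS2 (smooth_vfield_at_near sX) (smooth_vfield_at_near sY) => q tX tY.
exact: (lc_torsion_free Hlc tX tY).
Qed.

Lemma smooth_lie_bracket X Y p : smooth_vfield_at X p -> smooth_vfield_at Y p ->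
  smooth_vfield_at (lie_bracket X Y) p.
Proof.
move=> sX sY; apply: smooth_vfield_at_eq (near_torsion sX sY) _.
exact: smooth_vfieldB (conn_smooth Hn sX sY) (conn_smooth Hn sY sX).
Qed.

Lemma near_lie_bracketDl X1 X2 Y p : smooth_vfield_at X1 p -> smooth_vfield_at X2 p ->
  smooth_vfield_at Y p -> \forall q \near p,
  lie_bracket (fun q => X1 q + X2 q) Y q = lie_bracket X1 Y q + lie_bracket X2 Y q.
Proof.
move=> s1 s2 sY.
apply: filterS3 (smooth_vfield_at_near s1) (smooth_vfield_at_near s2)
  (smooth_vfield_at_near sY) => q t1 t2 tY.
rewrite -(lc_torsion_free Hlc t1 tY) -(lc_torsion_free Hlc t2 tY).
rewrite -(lc_torsion_free Hlc (smooth_vfieldD t1 t2) tY).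
by rewrite (conn_addl Hn t1 t2 tY) (conn_addr Hn tY t1 t2) opprD addrACA.
Qed.

Lemma near_lie_bracketZl f X Y p : smooth_fun_at f p -> smooth_vfield_at X p ->
  smooth_vfield_at Y p -> \forall q \near p,
  lie_bracket (fun q => f q *: X q) Y q = f q *: lie_bracket X Y q + (- vderive Y f q) *: X q.
Proof.
move=> sf sX sY.
apply: filterS3 (smooth_fun_at_near sf) (smooth_vfield_at_near sX)
  (smooth_vfield_at_near sY) => q tf tX tY.
rewrite -(lc_torsion_free Hlc (smooth_vfieldZ tf tX) tY) -(lc_torsion_free Hlc tX tY).
rewrite (conn_scalel Hn tf tX tY) (conn_leibniz Hn tf tY tX) scalerBr scaleNr opprD.
by rewrite addrA addrAC.
Qed.

Lemma curvature_antisym X Y Z p : smooth_vfield_at X p -> smooth_vfield_at Y p ->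
  smooth_vfield_at Z p -> curvature nabla Y X Z p = - curvature nabla X Y Z p.
Proof.
move=> sX sY sZ; rewrite /curvature.
have -> : lie_bracket Y X = (fun q => (-1) *: lie_bracket X Y q).
  by apply/funext => q; rewrite /lie_bracket scaleN1r opprB.
rewrite (conn_scalel Hn (smooth_fun_cst _ _) (smooth_lie_bracket sX sY) sZ).
have rearrange (A B L : 'rV[R]_3) : B - A - (-1) *: L = - (A - B - L).
  by apply/rowP => i; rewrite !mxE; ring.
exact: rearrange.
Qed.

(** For a multiple f X, the term - (Y f) nabla_X Z coming from the second
    covariant derivative cancels the one coming from
    [f X, Y] = f [X, Y] - (Y f) X. *)
Lemma curvature_tensorial1 Y Z p : smooth_vfield_at Y p -> smooth_vfield_at Z p ->
  tensorial_at p (fun X => curvature nabla X Y Z p).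
Proof.
move=> sY sZ; have sN := conn_smooth Hn; have sNYZ := sN _ _ _ sY sZ.
split=> [X1 X2 s1 s2|f X sf sX]; rewrite /curvature.
  rewrite (conn_addl Hn s1 s2 sNYZ).
  have E : \forall q \near p, nabla (fun q => X1 q + X2 q) Z q = nabla X1 Z q + nabla X2 Z q.
    apply: filterS3 (smooth_vfield_at_near s1) (smooth_vfield_at_near s2)
      (smooth_vfield_at_near sZ) => q; exact: (conn_addl Hn).
  rewrite (nabla_near Hn sY (sN _ _ _ (smooth_vfieldD s1 s2) sZ) E).
  rewrite (conn_addr Hn sY (sN _ _ _ s1 sZ) (sN _ _ _ s2 sZ)).
  have EL : nabla (lie_bracket (fun q => X1 q + X2 q) Y) Z p =
      nabla (lie_bracket X1 Y) Z p + nabla (lie_bracket X2 Y) Z p.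
    refine (etrans (tensorial_near (nabla_tensorial Hn sZ)
      (smooth_lie_bracket (smooth_vfieldD s1 s2) sY) (near_lie_bracketDl s1 s2 sY)) _).
    exact: (conn_addl Hn (smooth_lie_bracket s1 sY) (smooth_lie_bracket s2 sY) sZ).
  rewrite [X in _ - X = _]EL.
  have rearrange (A1 A2 B1 B2 C1 C2 : 'rV[R]_3) :
      A1 + A2 - (B1 + B2) - (C1 + C2) = A1 - B1 - C1 + (A2 - B2 - C2).
    by apply/rowP => i; rewrite !mxE; ring.
  exact: rearrange.
have sfX := smooth_vfieldZ sf sX; have sL := smooth_lie_bracket sX sY.
rewrite (conn_scalel Hn sf sX sNYZ).
have E : \forall q \near p, nabla (fun q => f q *: X q) Z q = f q *: nabla X Z q.
  apply: filterS3 (smooth_fun_at_near sf) (smooth_vfield_at_near sX)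
      (smooth_vfield_at_near sZ) => q; exact: (conn_scalel Hn).
rewrite (nabla_near Hn sY (sN _ _ _ sfX sZ) E).
rewrite (conn_leibniz Hn sf sY (sN _ _ _ sX sZ)).
have sd : smooth_fun_at (fun q => - vderive Y f q) p.
  have -> : (fun q => - vderive Y f q) = (fun q => -1 * vderive Y f q).
    by apply/funext => q; rewrite mulN1r.
  exact: smooth_funM (smooth_fun_cst _ _) (smooth_vderive sY sf).
have EL : nabla (lie_bracket (fun q => f q *: X q) Y) Z p =
    f p *: nabla (lie_bracket X Y) Z p + (- vderive Y f p) *: nabla X Z p.
  refine (etrans (tensorial_near (nabla_tensorial Hn sZ) (smooth_lie_bracket sfX sY)
    (near_lie_bracketZl sf sX sY)) _).
  rewrite (conn_addl Hn (smooth_vfieldZ sf sL) (smooth_vfieldZ sd sX) sZ).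
  by rewrite (conn_scalel Hn sf sL sZ) (conn_scalel Hn sd sX sZ).
rewrite [X in _ - X = _]EL.
have rearrange (a b : R) (A B C N : 'rV[R]_3) :
    a *: A - (b *: N + a *: B) - (a *: C + (- b) *: N) = a *: (A - B - C).
  by apply/rowP => i; rewrite !mxE; ring.
exact: rearrange.
Qed.

Lemma curvature_tensorial2 X Z p : smooth_vfield_at X p -> smooth_vfield_at Z p ->
  tensorial_at p (fun Y => curvature nabla X Y Z p).
Proof.
move=> sX sZ.
apply: tensorial_ext (tensorial_scale (-1) (curvature_tensorial1 sX sZ)) => Y sY.
by rewrite (curvature_antisym sY sX sZ) scaleN1r.
Qed.

Lemma curvature_const c u v Z p : smooth_chart c -> cdom c p -> smooth_vfield_at Z p ->
  let U := const_field c u in let V := const_field c v in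
  curvature nabla U V Z p = nabla U (nabla V Z) p - nabla V (nabla U Z) p.
Proof.
move=> sc cp sZ U V; rewrite /curvature.
have E : \forall q \near p, (fun _ => 0) q = lie_bracket U V q.
  by apply: filterS (near_cdom cp) => q cq; rewrite lie_bracket_const.
have HT := nabla_tensorial Hn sZ.
by rewrite -(tensorial_near HT (smooth_vfield0 p) E) (tensorial0 HT) subr0.
Qed.

(** On commuting fields the terms with first derivatives of f are symmetric in the
    two fields, and so is the second derivative of f. *)
Lemma curvature_const_tensorial3 c u v p : smooth_chart c -> cdom c p ->
  tensorial_at p (fun Z => curvature nabla (const_field c u) (const_field c v) Z p).
Proof.
move=> sc cp; set U := const_field c u; set V := const_field c v.
have sU : smooth_vfield_at U p := smooth_const_field _ sc cp.
have sV : smooth_vfield_at V p := smooth_const_field _ sc cp.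
have sN := conn_smooth Hn.
have second A B Z1 Z2 : smooth_vfield_at A p -> smooth_vfield_at B p ->
    smooth_vfield_at Z1 p -> smooth_vfield_at Z2 p ->
    nabla A (nabla B (fun q => Z1 q + Z2 q)) p =
    nabla A (nabla B Z1) p + nabla A (nabla B Z2) p.
  move=> sA sB s1 s2.
  have E : \forall q \near p, nabla B (fun q => Z1 q + Z2 q) q = nabla B Z1 q + nabla B Z2 q.
    apply: filterS3 (smooth_vfield_at_near sB) (smooth_vfield_at_near s1)
      (smooth_vfield_at_near s2) => q; exact: (conn_addr Hn).
  rewrite (nabla_near Hn sA (sN _ _ _ sB (smooth_vfieldD s1 s2)) E).
  exact: (conn_addr Hn sA (sN _ _ _ sB s1) (sN _ _ _ sB s2)).
have secondZ A B f Z : smooth_vfield_at A p -> smooth_vfield_at B p ->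
    smooth_fun_at f p -> smooth_vfield_at Z p ->
    nabla A (nabla B (fun q => f q *: Z q)) p =
    (vderive A (vderive B f) p *: Z p + vderive B f p *: nabla A Z p) + 
    (vderive A f p *: nabla B Z p + f p *: nabla A (nabla B Z) p).
  move=> sA sB sf sZ.
  have E : \forall q \near p, nabla B (fun q => f q *: Z q) q =
      vderive B f q *: Z q + f q *: nabla B Z q.
    apply: filterS3 (smooth_vfield_at_near sB) (smooth_fun_at_near sf)
      (smooth_vfield_at_near sZ) => q tB tf tZ; exact: (conn_leibniz Hn).
  have sBf := smooth_vderive sB sf.
  have sBZ := sN _ _ _ sB sZ.
  rewrite (nabla_near Hn sA (sN _ _ _ sB (smooth_vfieldZ sf sZ)) E).
  rewrite (conn_addr Hn sA (smooth_vfieldZ sBf sZ) (smooth_vfieldZ sf sBZ)).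
  by rewrite (conn_leibniz Hn sBf sA sZ) (conn_leibniz Hn sf sA sBZ).
have K := curvature_const u v sc cp.
split=> [Z1 Z2 s1 s2|f Z sf sZ].
  rewrite (K _ s1) (K _ s2) (K _ (smooth_vfieldD s1 s2)).
  have E := congr2 +%R (second _ _ _ _ sU sV s1 s2)
    (congr1 -%R (second _ _ _ _ sV sU s1 s2)).
  by refine (etrans E _); rewrite opprD addrACA.
rewrite (K _ sZ) (K _ (smooth_vfieldZ sf sZ)).
have C := vderive_const_comm u v sc cp sf.
have EV := secondZ _ _ _ _ sV sU sf sZ; rewrite -C in EV.
have E := congr2 +%R (secondZ _ _ _ _ sU sV sf sZ) (congr1 -%R EV).
have rearrange (d a b r : R) (A B N1 N2 N : 'rV[R]_3) :
    (d *: N + b *: N1) + (a *: N2 + r *: A) -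
    ((d *: N + a *: N2) + (b *: N1 + r *: B)) = r *: (A - B).
  by apply/rowP => i; rewrite !mxE; ring.
exact: etrans E (rearrange _ _ _ _ _ _ _ _ _).
Qed.

(** By tensoriality in the first two arguments these may be taken among the
    coordinate fields, which commute. *)
Lemma curvature_tensorial3 X Y p : smooth_vfield_at X p -> smooth_vfield_at Y p ->
  tensorial_at p (fun Z => curvature nabla X Y Z p).
Proof.
move=> sX sY; set c := chart_at p.
have cp : cdom c p := chart_at_dom p; have sc : smooth_chart c := @smooth_chart_at _ _ p.
have sE i := smooth_const_field (delta_mx 0 i) sc cp.
pose E i := const_field c (delta_mx 0 i).
apply: (@tensorial_ext _ _ (fun Z => \sum_i X p 0 i *: \sum_j Y p 0 j *:
    curvature nabla (E i) (E j) Z p)).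
  move=> Z sZ; rewrite (tensorial_expansion (curvature_tensorial1 sY sZ) sX).
  apply: eq_bigr => i _; congr (_ *: _).
  by rewrite (tensorial_expansion (curvature_tensorial2 (sE i) sZ) sY).
apply: tensorial_bigsum => i; apply: tensorial_scale.
apply: tensorial_bigsum => j; apply: tensorial_scale.
exact: curvature_const_tensorial3.
Qed.

End LeviCivita.

End Vderive.

(** * The Ricci tensor of a diagonal metric *)

Lemma sum_I3 (V : nmodType) (a b c : 'I_3) (F : 'I_3 -> V) : a != b -> a != c -> b != c ->
  \sum_e F e = F a + F b + F c.
Proof.
move=> ab ac bc; rewrite (bigD1 a) // (bigD1 b) /= 1?eq_sym // (bigD1 c) /=; last first.
  by rewrite eq_sym ac eq_sym bc.
rewrite big_pred0 ?addr0 ?addrA // => d.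
apply/negbTE; move: ab ac bc.
case: a b c d => [[|[|[|//]]] ?] [[|[|[|//]]] ?] [[|[|[|//]]] ?] [[|[|[|//]]] ?] //.
Qed.

(** The metric is diagonal with entries k_i m_i, where the k_i are constants; dm a i
    and ddm a b i stand for the first and second derivatives of m_i at a point
    along commuting directions.  The Christoffel symbols are of the first kind,
    so that no derivative of the inverse metric occurs. *)
Section DiagonalJet.
Variable (R : realFieldType).
Variables (k m : 'I_3 -> R) (dm : 'I_3 -> 'I_3 -> R) (ddm : 'I_3 -> 'I_3 -> 'I_3 -> R).

Definition diag_entry b : R := k b * m b.
Definition diag_d a b d : R := (b == d)%:R * (k b * dm a b).
Definition diag_dd a a' b d : R := (b == d)%:R * (k b * ddm a a' b).
Definition diag_christoffel a b d : R :=
  2^-1 * (diag_d a b d + diag_d b a d - diag_d d a b).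
Definition diag_dchristoffel l a b d : R :=
  2^-1 * (diag_dd l a b d + diag_dd l b a d - diag_dd l d a b).
Definition diag_riemann a b c d : R :=
  (diag_dchristoffel a b c d -
    \sum_e diag_christoffel b c e * diag_christoffel a d e / diag_entry e) -
  (diag_dchristoffel b a c d -
    \sum_e diag_christoffel a c e * diag_christoffel b d e / diag_entry e).
Definition diag_ricci b c : R := \sum_a diag_riemann a b c a / diag_entry a.

Hypothesis k_neq0 : forall i, k i != 0.
Hypothesis m_neq0 : forall i, m i != 0.
Hypothesis ddmC : forall a b i, ddm a b i = ddm b a i.
Variables (a b c : 'I_3).
Hypotheses (ab : a != b) (ac : a != c) (bc : b != c).

(** The constants k_i cancel: each term of the curvature component is homogeneous of
    degree one in the metric entry of the direction a that is traced out, and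
    of degree zero in the two others. *)
Lemma diag_ricci_off : diag_ricci b c = 
  (4^-1 * (dm c b * dm b a / m b + dm b c * dm c a / m c + dm b a * dm c a / m a)
   - 2^-1 * ddm b c a) / m a.
Proof.
have S F := sum_I3 F ab ac bc.
rewrite /diag_ricci S /diag_riemann !S /diag_dchristoffel /diag_christoffel /diag_d /diag_dd.
rewrite ?(eq_sym b a) ?(eq_sym c a) ?(eq_sym c b) ?eqxx (negbTE ab) (negbTE ac) (negbTE bc) /=.
rewrite /diag_entry.
rewrite ?(ddmC b a) ?(ddmC c a) ?(ddmC c b).
have ka := k_neq0 a; have kb := k_neq0 b; have kc := k_neq0 c.
have ma := m_neq0 a; have mb := m_neq0 b; have mc := m_neq0 c.
field.
by rewrite ka kb kc ma mb mc.
Qed.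

Let h := diag_entry.
Let dh x i := k i * dm x i.
Let ddh x y i := k i * ddm x y i.

(** The component R(x, b, b, x) of the curvature, y being the third direction. *)
Definition diag_sectional x b y := 
  4^-1 * (dh b x ^+ 2 / h x + dh x b ^+ 2 / h b + dh b b * dh b x / h b
          + dh x x * dh x b / h x - dh y x * dh y b / h y)
  - 2^-1 * (ddh b b x + ddh x x b).

Lemma diag_ricci_diag :
  diag_ricci b b = diag_sectional a b c / h a + diag_sectional c b a / h c.
Proof.
have S F := sum_I3 F ab ac bc.
rewrite /diag_ricci S /diag_riemann !S /diag_dchristoffel /diag_christoffel /diag_d /diag_dd.
rewrite ?(eq_sym b a) ?(eq_sym c a) ?(eq_sym c b) ?eqxx (negbTE ab) (negbTE ac) (negbTE bc) /=.
rewrite /diag_sectional /h /dh /ddh /diag_entry.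
rewrite ?(ddmC b a) ?(ddmC c a) ?(ddmC c b).
have ka := k_neq0 a; have kb := k_neq0 b; have kc := k_neq0 c.
have ma := m_neq0 a; have mb := m_neq0 b; have mc := m_neq0 c.
field.
by rewrite ka kb kc ma mb mc.
Qed.

End DiagonalJet.

(** The directions b and c span the plane and a is the axis.  In the entry b, b of
    the Ricci tensor each term is either free of the constants, or k_b / k_a times
    an expression that is the same for b and for c; so the changes of the entries
    b, b and c, c are in the ratio 1 : r. *)
Lemma diag_ricci_rescale (R : realFieldType) (k k' m : 'I_3 -> R)
    (dm : 'I_3 -> 'I_3 -> R) (ddm : 'I_3 -> 'I_3 -> 'I_3 -> R) (a b c : 'I_3) (r : R) :
  (forall i, k i != 0) -> (forall i, k' i != 0) -> (forall i, m i != 0) ->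
  (forall x y i, ddm x y i = ddm y x i) ->
  a != b -> a != c -> b != c ->
  m c = m b -> (forall x, dm x c = dm x b) -> (forall x y, ddm x y c = ddm x y b) ->
  r != 0 -> k c = r * k b -> k' c = r * k' b ->
  diag_ricci k' m dm ddm c c - diag_ricci k m dm ddm c c =
  r * (diag_ricci k' m dm ddm b b - diag_ricci k m dm ddm b b).
Proof.
move=> k0 k'0 m0 ddmC ab ac bc mE dmE ddmE r0 kE k'E.
have cb : c != b by rewrite eq_sym.
rewrite (diag_ricci_diag dm k0 m0 ddmC ab ac bc) (diag_ricci_diag dm k'0 m0 ddmC ab ac bc).
rewrite (diag_ricci_diag dm k0 m0 ddmC ac ab cb) (diag_ricci_diag dm k'0 m0 ddmC ac ab cb).
rewrite /diag_sectional /diag_entry !ddmE !dmE mE kE k'E.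
have ka := k0 a; have kb := k0 b; have ka' := k'0 a; have kb' := k'0 b.
have ma := m0 a; have mb := m0 b.
field.
by rewrite r0 ka kb ka' kb' ma mb.
Qed.

(** With three directions, b and c leave exactly one to trace out. *)
Lemma diag_ricci_off_rescale (R : realFieldType) (k k' m : 'I_3 -> R)
    (dm : 'I_3 -> 'I_3 -> R) (ddm : 'I_3 -> 'I_3 -> 'I_3 -> R) (b c : 'I_3) :
  (forall i, k i != 0) -> (forall i, k' i != 0) -> (forall i, m i != 0) ->
  (forall x y i, ddm x y i = ddm y x i) -> b != c ->
  diag_ricci k' m dm ddm b c = diag_ricci k m dm ddm b c.
Proof.
move=> k0 k'0 m0 ddmC bc.
have [a ab ac] : exists2 a, a != b & a != c.
  have : (0 < #|~: [set b; c]|)%N.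
    by have := cardsC [set b; c]; rewrite card_ord cards2 bc => /eqP; case: #|_|.
  by case/card_gt0P => a; rewrite !inE negb_or => /andP[]; exists a.
by rewrite (diag_ricci_off dm k0 m0 ddmC ab ac bc) (diag_ricci_off dm k'0 m0 ddmC ab ac bc).
Qed.

(** * Curvature in a commuting orthogonal frame *)

Lemma scalar_sum (R : pzRingType) (V : lmodType R) (L : V -> R) n (g : 'I_n -> R)
    (f : 'I_n -> V) : scalar L -> L (\sum_e g e *: f e) = \sum_e g e * L (f e).
Proof.
move=> HL; elim: (index_enum _) => [|i r IHr]; last by rewrite !big_cons HL IHr.
by rewrite !big_nil; have := HL (-1) 0 0; rewrite scaler0 addr0 mulN1r addNr.
Qed.

(** Valid for an indefinite form as well: the coefficient of v on f e is
    h v (f e) / D e. *)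
Lemma orthogonal_expansion (R : fieldType) (h : 'rV[R]_3 -> 'rV[R]_3 -> R)
    (f : 'I_3 -> 'rV[R]_3) (D : 'I_3 -> R) :
  (forall v, scalar (h^~ v)) -> (forall u, scalar (h u)) ->
  row_free (\matrix_i f i) ->
  (forall b d, h (f b) (f d) = (b == d)%:R * D b) -> (forall b, D b != 0) ->
  forall u v, h u v = \sum_e h u (f e) * h v (f e) / D e.
Proof.
move=> hl hr free orth D0 u v.
have sumr x (g : 'I_3 -> R) : h x (\sum_e g e *: f e) = \sum_e g e * h x (f e).
  exact: scalar_sum (hr x).
have suml x (g : 'I_3 -> R) : h (\sum_e g e *: f e) x = \sum_e g e * h (f e) x.
  exact: (scalar_sum (L := h^~ x)).
pose P := \matrix_i f i; pose y := v *m invmx P.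
have vE : v = \sum_e y 0 e *: f e.
  have uP : P \in unitmx by rewrite -row_free_unit.
  rewrite -[LHS](mulmxKV uP) -/y.
  rewrite mulmx_sum_row; apply: eq_bigr => e _; congr (_ *: _).
  by apply/rowP => j; rewrite !mxE.
have yE e : h v (f e) = y 0 e * D e.
  rewrite vE suml (bigD1 e) //= orth eqxx mul1r big1 ?addr0 // => d de.
  by rewrite orth (negbTE de) mul0r mulr0.
rewrite [in LHS]vE sumr; apply: eq_bigr => e _.
by rewrite yE mulrCA mulrA mulfK // mulrC.
Qed.

Section Frame.
Variables (R : realType) (M : manifold3 R).

(** The properties shared by g and its associated metric, which is indefinite. *)
Record smooth_form (h : formfield M) : Prop := SmoothForm {
  form_linear_l : forall p v, scalar (fun u => h p u v);
  form_linear_r : forall p u, scalar (h p u);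
  form_sym : forall p u v, h p u v = h p v u;
  form_smooth : forall X Y p, smooth_vfield_at X p -> smooth_vfield_at Y p ->
    smooth_fun_at (apply_form h X Y) p }.

Lemma vderive_comb3 (X : vfield M) (c1 c2 c3 : R) (f1 f2 f3 : M -> R) p :
  smooth_fun_at f1 p -> smooth_fun_at f2 p -> smooth_fun_at f3 p ->
  vderive X (fun q => c1 * f1 q + c2 * f2 q + c3 * f3 q) p =
  c1 * vderive X f1 p + c2 * vderive X f2 p + c3 * vderive X f3 p.
Proof.
move=> s1 s2 s3.
have sM c f : smooth_fun_at f p -> smooth_fun_at (fun q => c * f q) p.
  exact: smooth_funM (smooth_fun_cst c p).
rewrite (vderiveD X (smooth_funD (sM c1 _ s1) (sM c2 _ s2)) (sM c3 _ s3)).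
rewrite (vderiveD X (sM c1 _ s1) (sM c2 _ s2)).
by rewrite (vderiveMl X c1 s1) (vderiveMl X c2 s2) (vderiveMl X c3 s3).
Qed.

Variables (h : formfield M) (nabla : connection M).
Hypothesis Hh : smooth_form h.
Hypothesis Hlc : levi_civita h nabla.
Let Hn := lc_affine Hlc.

Variables (c : chart R M) (w : 'I_3 -> 'rV[R]_3).
Hypothesis sc : smooth_chart c.
Let F a := const_field c (w a).

Variables (k : 'I_3 -> R) (m : 'I_3 -> M -> R).
Hypothesis sm : forall b q, cdom c q -> smooth_fun_at (m b) q.
Hypothesis orth : forall q, cdom c q -> forall b d,
  apply_form h (F b) (F d) q = (b == d)%:R * (k b * m b q).

Let dm q a i := vderive (F a) (m i) q.
Let ddm q a b i := vderive (F a) (vderive (F b) (m i)) q.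

Lemma smooth_frame a q : cdom c q -> smooth_vfield_at (F a) q.
Proof. exact: smooth_const_field. Qed.

Lemma vderive_frame_form q a b d : cdom c q ->
  vderive (F a) (apply_form h (F b) (F d)) q = diag_d k (dm q) a b d.
Proof.
move=> cq.
have E : \forall q' \near q, apply_form h (F b) (F d) q' =
    (fun q => (b == d)%:R * k b * m b q) q'.
  by apply: filterS (near_cdom cq) => q' cq'; rewrite (orth cq') mulrA.
refine (etrans (vderive_eq _ E) _).
by rewrite (vderiveMl (F a) _ (sm b cq)) -mulrA.
Qed.

(** The Koszul formula: metric compatibility for the three choices of the
    differentiating field, and symmetry of nabla_a F_b in a and b because the
    frame commutes. *)
Lemma frame_christoffel q a b d : cdom c q ->
  apply_form h (nabla (F a) (F b)) (F d) q = diag_christoffel k (dm q) a b d.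
Proof.
move=> cq; have sF i := smooth_frame i cq.
pose G i j l := apply_form h (nabla (F i) (F j)) (F l) q.
have met i j l : diag_d k (dm q) i j l = G i j l + G i l j.
  rewrite -(vderive_frame_form i j l cq) (lc_metric Hlc (sF i) (sF j) (sF l)).
  by rewrite [X in _ + X](form_sym Hh).
have tor i j l : G i j l = G j i l.
  have T := lc_torsion_free Hlc (sF i) (sF j).
  rewrite (lie_bracket_const (w i) (w j) sc cq) in T.
  exact (congr1 (fun u => h q u (F l q)) (subr0_eq T)).
rewrite -[LHS]/(G a b d) /diag_christoffel (met a b d) (met b a d) (met d a b).
rewrite (tor b a d) (tor d a b) (tor d b a).
move: (G a b d) (G a d b) (G b d a) => x y z; lra.
Qed.

Lemma vderive_christoffel p l a b d : cdom c p ->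
  vderive (F l) (apply_form h (nabla (F a) (F b)) (F d)) p =
  diag_dchristoffel k (ddm p) l a b d.
Proof.
move=> cp.
pose G := fun q => 2^-1 * (b == d)%:R * k b * dm q a b +
  2^-1 * (a == d)%:R * k a * dm q b a + (- 2^-1 * (a == b)%:R * k a) * dm q d a.
have E : \forall q \near p, apply_form h (nabla (F a) (F b)) (F d) q = G q.
  apply: filterS (near_cdom cp) => q cq.
  rewrite (frame_christoffel a b d cq) /G /diag_christoffel /diag_d.
  move: (dm q a b) (dm q b a) (dm q d a) => x y z; ring.
refine (etrans (vderive_eq _ E) _).
have s i j := smooth_vderive_const (w i) sc cp (sm j cp).
have combine (x y z : R) : 2^-1 * (b == d)%:R * k b * x + 2^-1 * (a == d)%:R * k a * y +
   (- 2^-1 * (a == b)%:R * k a) * z = 2^-1 * ((b == d)%:R * (k b * x) +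
   (a == d)%:R * (k a * y) - (a == b)%:R * (k a * z)) by ring.
exact: etrans (vderive_comb3 (F l) _ _ _ (s a b) (s b a) (s d a)) (combine _ _ _).
Qed.

Variable p : M.
Hypothesis cp : cdom c p.
Hypothesis free : row_free (\matrix_i F i p).
Hypothesis D0 : forall b, k b * m b p != 0.

(** By metric compatibility h (nabla_a nabla_b F_d, F_e) is the derivative of a
    Christoffel symbol of the first kind minus h (nabla_b F_d, nabla_a F_e),
    and the latter is expanded in the orthogonal frame. *)
Lemma frame_curvature a b d e :
  curvature4 h nabla (F a) (F b) (F d) (F e) p =
  diag_riemann k (m^~ p) (dm p) (ddm p) a b d e.
Proof.
have sF i := smooth_frame i cp.
have sN i j := conn_smooth Hn (sF i) (sF j).
have prod i j l n : h p (nabla (F i) (F j) p) (nabla (F l) (F n) p) =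
   \sum_e diag_christoffel k (dm p) i j e * diag_christoffel k (dm p) l n e /
     diag_entry k (m^~ p) e.
  rewrite (orthogonal_expansion (form_linear_l Hh p) (form_linear_r Hh p) free (orth cp) D0).
  by apply: eq_bigr => x _; rewrite -!(frame_christoffel _ _ _ cp).
have term i j : h p (nabla (F i) (nabla (F j) (F d)) p) (F e p) =
   diag_dchristoffel k (ddm p) i j d e -
   \sum_x diag_christoffel k (dm p) j d x * diag_christoffel k (dm p) i e x /
     diag_entry k (m^~ p) x.
  rewrite -(vderive_christoffel i j d e cp) (lc_metric Hlc (sF i) (sN j d) (sF e)).
  by rewrite -prod addrK.
have hB u v x : h p (u - v) x = h p u x - h p v x.
  by rewrite -[u - v]addrC -scaleN1r (form_linear_l Hh p x) mulN1r addrC.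
rewrite /curvature4 /apply_form (curvature_const Hlc (w a) (w b) sc cp (sF d)).
by rewrite hB; exact: congr2 (term a b) (congr1 -%R (term b a)).
Qed.

End Frame.

(** * Bilinear tensors at a point and their metric traces *)

Lemma invmx_eq (K : comUnitRingType) n (A B : 'M[K]_n) : A *m B = 1%:M -> invmx A = B.
Proof. by move=> AB; have [uA _] := mulmx1_unit AB; rewrite -[LHS]mulmx1 -AB mulKmx. Qed.

Section Bitensor.
Variables (R : realType) (M : manifold3 R).
Implicit Types (p : M) (T : vfield M -> vfield M -> M -> R) (e F : 'I_3 -> vfield M).

Definition bitensorial_at p T : Prop :=
  (forall Y, smooth_vfield_at Y p -> @tensorial_at _ _ p R^o (fun X => T X Y p)) /\
  (forall X, smooth_vfield_at X p -> @tensorial_at _ _ p R^o (fun Y => T X Y p)).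

Lemma bitensor_matrix p T : bitensorial_at p T ->
  exists A : 'M[R]_3, forall X Y, smooth_vfield_at X p -> smooth_vfield_at Y p ->
    T X Y p = (X p *m A *m (Y p)^T) 0 0.
Proof.
move=> [T1 T2]; set c := chart_at p.
have cp : cdom c p := chart_at_dom p; have sc : smooth_chart c := @smooth_chart_at _ _ p.
pose E i := const_field c (delta_mx 0 i).
have sE i : smooth_vfield_at (E i) p := smooth_const_field _ sc cp.
exists (\matrix_(i, j) T (E i) (E j) p) => X Y sX sY.
refine (etrans (tensorial_expansion (T1 _ sY) sX) _); rewrite mxE.
under [RHS]eq_bigr do rewrite mxE mulr_suml.
rewrite exchange_big; apply: eq_bigr => i _.
refine (etrans (congr1 ( *:%R (X p 0 i)) (tensorial_expansion (T2 _ (sE i)) sY)) _).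
rewrite scaler_sumr.
apply: eq_bigr => j _; rewrite !mxE -[LHS]/(_ * (_ * _)).
by rewrite mulrA mulrAC.
Qed.

Definition frame_mx e p : 'M[R]_3 := \matrix_i e i p.

Lemma bitensor_frame p T (A : 'M[R]_3) e : (forall i, smooth_vfield_at (e i) p) ->
  (forall X Y, smooth_vfield_at X p -> smooth_vfield_at Y p ->
    T X Y p = (X p *m A *m (Y p)^T) 0 0) ->
  \matrix_(i, j) T (e i) (e j) p = frame_mx e p *m A *m (frame_mx e p)^T.
Proof.
move=> se HA; apply/matrixP => i j; rewrite mxE (HA _ _ (se i) (se j)).
have rowE l : e l p = row l (frame_mx e p) by rewrite rowK.
by rewrite !rowE -row_mul tr_row -[LHS]/((_ *m _) 0 0) mxE [RHS]mxE;
   apply: eq_bigr => l _; rewrite !mxE.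
Qed.

(** The matrix of a frame is invertible, so the values on the frame determine the
    matrix of the tensor. *)
Lemma bitensor_ext p T T' F : bitensorial_at p T -> bitensorial_at p T' ->
  local_frame_at F p -> (forall b d, T (F b) (F d) p = T' (F b) (F d) p) ->
  forall X Y, smooth_vfield_at X p -> smooth_vfield_at Y p -> T X Y p = T' X Y p.
Proof.
move=> /bitensor_matrix[A HA] /bitensor_matrix[A' HA'] [sF freeF] E X Y sX sY.
have uP : frame_mx F p \in unitmx by rewrite -row_free_unit.
have EP : frame_mx F p *m A *m (frame_mx F p)^T = frame_mx F p *m A' *m (frame_mx F p)^T.
  rewrite -(bitensor_frame sF HA) -(bitensor_frame sF HA').
  by apply/matrixP => i j; rewrite !mxE E.
have uPT : (frame_mx F p)^T \in unitmx by rewrite unitmx_tr.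
have EA : A = A'.
  apply: (can_inj (mulKmx uP)); apply: (can_inj (mulmxK uPT)); exact: EP.
by rewrite (HA _ _ sX sY) (HA' _ _ sX sY) EA.
Qed.

(** A change of frame acts by congruence on both matrices, so it conjugates their
    quotient: the trace does not depend on the frame. *)
Lemma metric_trace_mx h p T (H A : 'M[R]_3) e :
  local_frame_at e p -> H \in unitmx ->
  (forall X Y, smooth_vfield_at X p -> smooth_vfield_at Y p ->
    apply_form h X Y p = (X p *m H *m (Y p)^T) 0 0) ->
  (forall X Y, smooth_vfield_at X p -> smooth_vfield_at Y p ->
    T X Y p = (X p *m A *m (Y p)^T) 0 0) ->
  metric_trace h e T p = \tr (invmx H *m A^T).
Proof.
move=> [se free] uH HH HA; set P := frame_mx e p.
have uP : P \in unitmx by rewrite -row_free_unit.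
have uPT : P^T \in unitmx by rewrite unitmx_tr.
have -> : metric_trace h e T p =
    \tr (invmx (gram h e p) *m (\matrix_(i, j) T (e i) (e j) p)^T).
  rewrite /metric_trace /mxtrace; apply: eq_bigr => i _; rewrite mxE.
  by apply: eq_bigr => j _; rewrite !mxE.
rewrite (bitensor_frame se HA) /gram (bitensor_frame (T := apply_form h) se HH) -/P.
have -> : invmx (P *m H *m P^T) = invmx P^T *m invmx H *m invmx P.
  by apply: invmx_eq; rewrite -!mulmxA (mulKVmx uPT) (mulKVmx uH) mulmxV.
rewrite !trmx_mul trmxK -mulmxA (mulKmx uP) mxtrace_mulC -!mulmxA.
by rewrite [P^T *m _]mulmxA mulmxV // mul1mx mxtrace_mulC.
Qed.

Lemma smooth_form_bitensorial h p : smooth_form h -> bitensorial_at p (apply_form h).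
Proof.
move=> Hh; split=> [Y _|X _].
  exact: (tensorial_value p (form_linear_l Hh p (Y p))).
exact: (tensorial_value p (form_linear_r Hh p (X p))).
Qed.

Lemma bitensorialD p T T' :
  bitensorial_at p T -> bitensorial_at p T' ->
  bitensorial_at p (fun X Y q => T X Y q + T' X Y q).
Proof.
move=> [T1 T2] [T1' T2']; split=> [Y sY|X sX].
  exact: (tensorial_add (T1 Y sY) (T1' Y sY)).
exact: (tensorial_add (T2 X sX) (T2' X sX)).
Qed.

Lemma bitensorialZ p (a : R) T :
  bitensorial_at p T -> bitensorial_at p (fun X Y q => a * T X Y q).
Proof.
move=> [T1 T2]; split=> [Y sY|X sX].
  exact: (tensorial_scale a (T1 Y sY)).
exact: (tensorial_scale a (T2 X sX)).
Qed.

Section OrthogonalFrame.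
Variables (h : formfield M) (p : M) (F : 'I_3 -> vfield M) (D : 'I_3 -> R).
Hypothesis Hh : smooth_form h.
Hypothesis sF : forall i, smooth_vfield_at (F i) p.
Hypothesis orth : forall b d, apply_form h (F b) (F d) p = (b == d)%:R * D b.
Hypothesis D0 : forall b, D b != 0.

Lemma gram_orth : gram h F p = diag_mx (\row_i D i).
Proof.
apply/matrixP => i j; rewrite !mxE orth.
by case: eqVneq => [->|]; rewrite ?mul1r ?mul0r ?mulr1n ?mulr0n.
Qed.

Lemma gram_orth_unit : gram h F p \in unitmx.
Proof.
rewrite gram_orth unitmxE det_diag unitfE.
by apply/prodf_neq0 => i _; rewrite mxE.
Qed.

(** Linear independence comes for free: the Gram matrix is invertible and factors
    through the matrix of the frame. *)
Lemma orthogonal_frame : local_frame_at F p.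
Proof.
split=> //; rewrite -/(frame_mx F p) row_free_unit.
have [H HH] := bitensor_matrix (smooth_form_bitensorial p Hh).
have := gram_orth_unit; rewrite /gram (bitensor_frame (T := apply_form h) sF HH).
by rewrite !unitmx_mul => /andP[/andP[]].
Qed.

Lemma metric_trace_orth e T : bitensorial_at p T -> local_frame_at e p ->
  metric_trace h e T p = \sum_a T (F a) (F a) p / D a.
Proof.
move=> /bitensor_matrix[A HA] he.
have [H HH] := bitensor_matrix (smooth_form_bitensorial p Hh).
have uH : H \in unitmx.
  have := gram_orth_unit; rewrite /gram (bitensor_frame (T := apply_form h) sF HH).
  by rewrite !unitmx_mul => /andP[/andP[]].
rewrite (metric_trace_mx he uH HH HA) -(metric_trace_mx orthogonal_frame uH HH HA).
have invE : invmx (gram h F p) = diag_mx (\row_i (D i)^-1).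
  apply: invmx_eq; rewrite gram_orth mulmx_diag; apply/matrixP => i j.
  by rewrite !mxE mulfV.
rewrite /metric_trace invE; apply: eq_bigr => a _; rewrite (bigD1 a) //=.
rewrite !mxE eqxx mulr1n big1 ?addr0 1?mulrC // => b ba.
by rewrite !mxE eq_sym (negbTE ba) mulr0n mul0r.
Qed.

End OrthogonalFrame.
End Bitensor.

(** * The Ricci tensor as a bilinear tensor *)

Section Ricci.
Variables (R : realType) (M : manifold3 R).
Variables (h : formfield M) (nabla : connection M).
Hypothesis Hh : smooth_form h.
Hypothesis Hlc : levi_civita h nabla.

Lemma curvature4_bitensorial14 Y Z p : smooth_vfield_at Y p -> smooth_vfield_at Z p ->
  bitensorial_at p (fun U V => curvature4 h nabla U Y Z V).
Proof.
move=> sY sZ; split=> [V _|U _].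
  exact: (tensorial_lcomp (form_linear_l Hh p (V p)) (curvature_tensorial1 Hlc sY sZ)).
exact: (tensorial_value p (form_linear_r Hh p (curvature nabla U Y Z p))).
Qed.

Lemma curvature4_bitensorial23 U V p : smooth_vfield_at U p ->
  bitensorial_at p (fun Y Z => curvature4 h nabla U Y Z V).
Proof.
move=> sU; split=> [Z sZ|Y sY].
  exact: (tensorial_lcomp (form_linear_l Hh p (V p)) (curvature_tensorial2 Hlc sU sZ)).
exact: (tensorial_lcomp (form_linear_l Hh p (V p)) (curvature_tensorial3 Hlc sU sY)).
Qed.

Lemma ricci_bitensorial e p : local_frame_at e p -> bitensorial_at p (ricci h nabla e).
Proof.
move=> [se _]; split=> [Z sZ|Y sY].
  apply: (tensorial_bigsum (W := R^o)) => i; apply: (tensorial_bigsum (W := R^o)) => j.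
  apply: (tensorial_scale (W := R^o)).
  exact: (curvature4_bitensorial23 (e j) (se i)).1 Z sZ.
apply: (tensorial_bigsum (W := R^o)) => i; apply: (tensorial_bigsum (W := R^o)) => j.
apply: (tensorial_scale (W := R^o)).
exact: (curvature4_bitensorial23 (e j) (se i)).2 Y sY.
Qed.

Variables (c : chart R M) (w : 'I_3 -> 'rV[R]_3).
Hypothesis sc : smooth_chart c.
Let F a := const_field c (w a).
Variables (k : 'I_3 -> R) (m : 'I_3 -> M -> R).
Hypothesis sm : forall b q, cdom c q -> smooth_fun_at (m b) q.
Hypothesis orth : forall q, cdom c q -> forall b d,
  apply_form h (F b) (F d) q = (b == d)%:R * (k b * m b q).
Variable p : M.
Hypothesis cp : cdom c p.
Hypothesis D0 : forall b, k b * m b p != 0.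

(** The trace over the given frame e is taken in the orthogonal frame instead. *)
Lemma ricci_diagonal e b d : local_frame_at e p ->
  ricci h nabla e (F b) (F d) p =
  diag_ricci k (m^~ p) (fun a i => vderive (F a) (m i) p)
    (fun a a' i => vderive (F a) (vderive (F a') (m i)) p) b d.
Proof.
move=> he; have sF i : smooth_vfield_at (F i) p := smooth_const_field (w i) sc cp.
have T := curvature4_bitensorial14 (sF b) (sF d).
rewrite /ricci (metric_trace_orth Hh sF (orth cp) D0 T he); apply: eq_bigr => a _.
have [_ free] := orthogonal_frame Hh sF (orth cp) D0.
by rewrite (frame_curvature Hh Hlc sc sm orth cp free D0).
Qed.

End Ricci.

(** * Circulant metrics *)

Definition triple (R : Type) (a b c : R) (i : 'I_3) : R :=
  if i == 0 then a else if i == 1 then b else c.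

Lemma forall_I3 (P : 'I_3 -> Prop) : P 0 -> P 1 -> P 2 -> forall i, P i.
Proof.
move=> P0 P1 P2 [[|[|[|//]]] Hi].
- by have -> : Ordinal Hi = 0 by apply/val_inj.
- by have -> : Ordinal Hi = 1 by apply/val_inj.
- by have -> : Ordinal Hi = 2 by apply/val_inj.
Qed.

Lemma sum3E (V : nmodType) (F : 'I_3 -> V) : \sum_i F i = F 0 + F 1 + F 2.
Proof. exact: sum_I3. Qed.

Section CirculantAlgebra.
Variables (R : realFieldType) (V : lmodType R) (G : V -> V -> R) (q : V -> V).
Variable (x : 'I_3 -> V).
Hypotheses (q0 : q (x 0) = x 1) (q1 : q (x 1) = x 2) (q2 : q (x 2) = x 0).

Lemma circulant_gram : (forall u v, G u v = G v u) ->
  (forall u v, G (q u) (q v) = G u v) -> forall i j,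
  G (x i) (x j) = (i == j)%:R * (G (x 0) (x 0) - G (x 0) (x 1)) + G (x 0) (x 1).
Proof.
move=> sym iso.
have e11 : G (x 1) (x 1) = G (x 0) (x 0) by rewrite -q0 iso.
have e12 : G (x 1) (x 2) = G (x 0) (x 1) by rewrite -[RHS]iso q0 q1.
have e22 : G (x 2) (x 2) = G (x 0) (x 0) by rewrite -q1 iso e11.
have e20 : G (x 2) (x 0) = G (x 0) (x 1) by rewrite -e12 -[RHS]iso q1 q2.
have e10 : G (x 1) (x 0) = G (x 0) (x 1) by rewrite sym.
have e21 : G (x 2) (x 1) = G (x 0) (x 1) by rewrite sym e12.
have e02 : G (x 0) (x 2) = G (x 0) (x 1) by rewrite sym e20.
by apply: forall_I3; apply: forall_I3; rewrite ?e11 ?e22 ?e12 ?e20 ?e10 ?e21 ?e02 /=; ring.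
Qed.

Lemma associated_gram (a b : R) :
  (forall i j, G (x i) (x j) = (i == j)%:R * (a - b) + b) -> forall i j,
  G (x i) (q (x j)) + G (q (x i)) (x j) = (i == j)%:R * (b - a) + (a + b).
Proof.
move=> GE; apply: forall_I3; apply: forall_I3; rewrite ?q0 ?q1 ?q2 !GE /=; ring.
Qed.

(** Orthogonal directions for every form with matrix a I + b J: the axis fixed by q,
    and two directions in the plane that q rotates. *)
Definition axis_plane : 'I_3 -> V :=
  triple (x 0 + x 1 + x 2) (x 0 - x 1) (x 0 + x 1 - 2 *: x 2).

Lemma axis_plane_diagonal (a b : R) :
  (forall v, scalar (G^~ v)) -> (forall u, scalar (G u)) ->
  (forall i j, G (x i) (x j) = (i == j)%:R * a + b) -> forall i j,
  G (axis_plane i) (axis_plane j) =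
    (i == j)%:R * triple (3 * a + 9 * b) (2 * a) (6 * a) i.
Proof.
move=> Gl Gr GE.
have Dl u v z : G (u + v) z = G u z + G v z by have := Gl z 1 u v; rewrite scale1r mul1r.
have Dr u v z : G u (v + z) = G u v + G u z by have := Gr u 1 v z; rewrite scale1r mul1r.
have Zl k u z : G (k *: u) z = k * G u z.
  have G0 : G 0 z = 0 by have := Gl z (-1) 0 0; rewrite scaler0 addr0 mulN1r addNr.
  by rewrite -[k *: u]addr0 Gl G0 addr0.
have Zr k u z : G u (k *: z) = k * G u z.
  have G0 : G u 0 = 0 by have := Gr u (-1) 0 0; rewrite scaler0 addr0 mulN1r addNr.
  by rewrite -[k *: z]addr0 Gr G0 addr0.
have E2 : x 0 - x 1 = x 0 + (-1) *: x 1 by rewrite scaleN1r.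
have E3 : x 0 + x 1 - 2 *: x 2 = x 0 + x 1 + (-2) *: x 2 by rewrite scaleNr.
by apply: forall_I3; apply: forall_I3; rewrite /axis_plane /triple /= ?E2 ?E3
  ?(Dl, Dr, Zl, Zr) ?GE /=; ring.
Qed.

End CirculantAlgebra.

Section Circulant.
Variables (R : realType) (M : manifold3 R) (g : formfield M) (Q : endofield M).
Hypotheses (hg : riemannian_metric g) (hQ : circulant_structure g Q).
Let gt := associated_metric g Q.

Lemma metric_smooth_form : smooth_form g.
Proof. by case: hg. Qed.

Lemma associated_smooth_form : smooth_form gt.
Proof.
have [gl gr gs _ gsm] := hg; have [Ql Qs _ _ _ _] := hQ.
split.
- move=> p v a x y; rewrite /gt /associated_metric Ql !gl.
  by rewrite mulrDr addrACA.
- move=> p v a x y; rewrite /gt /associated_metric Ql !gr.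
  by rewrite mulrDr addrACA.
- by move=> p u v; rewrite /gt /associated_metric addrC gs (gs p u).
- move=> X Y p sX sY.
  exact: smooth_funD (gsm _ _ _ sX (Qs _ _ sY)) (gsm _ _ _ (Qs _ _ sX) sY).
Qed.

Variables (c : chart R M).
Hypothesis sc : smooth_chart c.
Hypothesis Qc : forall q, cdom c q -> forall j,
  Q q (coord_field c j q) = \sum_(s < 3) circulant_mx R j s *: coord_field c s q.
Hypothesis AB : forall q, cdom c q ->
  0 < g q (coord_field c 0 q) (coord_field c 1 q)
    < g q (coord_field c 0 q) (coord_field c 0 q).

Let A := apply_form g (coord_field c 0) (coord_field c 0).
Let B := apply_form g (coord_field c 0) (coord_field c 1).
Let F i := const_field c (axis_plane (fun j => delta_mx 0 j) i).

Lemma circulant_step q : cdom c q ->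
  [/\ Q q (coord_field c 0 q) = coord_field c 1 q,
      Q q (coord_field c 1 q) = coord_field c 2 q &
      Q q (coord_field c 2 q) = coord_field c 0 q].
Proof.
by move=> cq; split; rewrite (Qc cq) sum3E;
   move: (coord_field c 0 q) (coord_field c 1 q) (coord_field c 2 q) => x y z;
   rewrite !mxE /= ?scale1r ?scale0r ?add0r ?addr0.
Qed.

Lemma metric_circulant q : cdom c q -> forall i j,
  g q (coord_field c i q) (coord_field c j q) = (i == j)%:R * (A q - B q) + B q.
Proof.
move=> cq; have [Q0 Q1 Q2] := circulant_step cq.
exact: (circulant_gram (x := fun i => coord_field c i q) Q0 Q1 Q2
  (Defs.metric_sym hg q) (circ_isometry hQ q)).
Qed.

Lemma associated_circulant q : cdom c q -> forall i j,
  gt q (coord_field c i q) (coord_field c j q) = (i == j)%:R * (B q - A q) + (A q + B q).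
Proof.
move=> cq; have [Q0 Q1 Q2] := circulant_step cq.
exact: (associated_gram (x := fun i => coord_field c i q) Q0 Q1 Q2 (metric_circulant cq)).
Qed.

Lemma frame_field q i : cdom c q -> F i q = axis_plane (fun j => coord_field c j q) i.
Proof.
move=> cq.
have D u v : const_field c (u + v) q = const_field c u q + const_field c v q.
  by rewrite -[u]scale1r (const_fieldP 1 u v sc cq) !scale1r.
have Z a u : const_field c (a *: u) q = a *: const_field c u q.
  rewrite -[a *: u]addr0 (const_fieldP a u 0 sc cq).
  by rewrite [const_field c 0 q]tangent_change0 addr0.
have N u : const_field c (- u) q = - const_field c u q.
  by rewrite -scaleN1r Z scaleN1r.
by move: i; apply: forall_I3; rewrite /F /axis_plane /triple /= ?D ?N ?Z.
Qed.

Lemma frame_form_diagonal (h : formfield M) (a b : R) q : smooth_form h -> cdom c q ->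
  (forall i j, h q (coord_field c i q) (coord_field c j q) = (i == j)%:R * a + b) ->
  forall i j, apply_form h (F i) (F j) q =
     (i == j)%:R * triple (3 * a + 9 * b) (2 * a) (6 * a) i.
Proof.
move=> Hh cq hE i j; rewrite /apply_form (frame_field i cq) (frame_field j cq).
exact: (axis_plane_diagonal (x := fun i => coord_field c i q)
  (form_linear_l Hh q) (form_linear_r Hh q) hE).
Qed.

(** The squares of F_0 and F_1 for g; that of F_2 is three times the latter. *)
Definition axis_scale : M -> R := fun q => 3 * A q + 6 * B q.
Definition plane_scale : M -> R := fun q => 2 * A q + (-2) * B q.
Let m := triple axis_scale plane_scale plane_scale.

Lemma smooth_scale b q : cdom c q -> smooth_fun_at (m b) q.
Proof.
move=> cq; have s i : smooth_vfield_at (coord_field c i) q := smooth_const_field _ sc cq.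
have sA : smooth_fun_at A q := Defs.metric_smooth hg (s 0) (s 0).
have sB : smooth_fun_at B q := Defs.metric_smooth hg (s 0) (s 1).
have sM (a : R) f : smooth_fun_at f q -> smooth_fun_at (fun x : M => a * f x) q.
  exact: smooth_funM (smooth_fun_cst a q).
have s0 : smooth_fun_at axis_scale q := smooth_funD (sM 3 _ sA) (sM 6 _ sB).
have s1 : smooth_fun_at plane_scale q := smooth_funD (sM 2 _ sA) (sM (-2) _ sB).
by move: b; apply: forall_I3.
Qed.

Lemma scale_gt0 b q : cdom c q -> 0 < m b q.
Proof.
move=> cq; have [B0 BA] : 0 < B q /\ B q < A q by apply/andP; exact: AB cq.
by move: b; apply: forall_I3; rewrite /m /triple /= /axis_scale /plane_scale;
   move: (A q) (B q) B0 BA => a b; lra.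
Qed.

Lemma metric_frame q : cdom c q -> forall b d, apply_form g (F b) (F d) q =
  (b == d)%:R * (triple 1 1 3 b * m b q).
Proof.
move=> cq b d.
rewrite (frame_form_diagonal metric_smooth_form cq (metric_circulant cq)); congr (_ * _).
by move: b; apply: forall_I3; rewrite /m /triple /= /axis_scale /plane_scale; ring.
Qed.

Lemma associated_frame q : cdom c q -> forall b d, apply_form gt (F b) (F d) q =
  (b == d)%:R * (triple 2 (-1) (-3) b * m b q).
Proof.
move=> cq b d.
rewrite (frame_form_diagonal associated_smooth_form cq (associated_circulant cq)).
congr (_ * _).
by move: b; apply: forall_I3; rewrite /m /triple /= /axis_scale /plane_scale; ring.
Qed.

End Circulant.

(** * The relation between the two Ricci tensors *)

(** The numbers r and s are the diagonal entries of two symmetric tensors that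
    differ by a diagonal one, whose plane part is proportional to (1, 3) as is
    the plane part of D and Dt.  Dividing by D and by Dt and summing gives the
    traces, and the difference is recovered from its two traces. *)
Lemma trace_coefficients (R : realFieldType) (m r s : 'I_3 -> R) :
  (forall i, m i != 0) -> m 2 = m 1 -> s 2 - r 2 = 3 * (s 1 - r 1) ->
  let D b := triple 1 1 3 b * m b in let Dt b := triple 2 (-1) (-3) b * m b in
  forall b,
    s b = r b + 3^-1 * (\sum_a s a / D a - \sum_a r a / D a) * D b
      + 6^-1 * (2 * (\sum_a s a / Dt a) - 2 * (\sum_a r a / Dt a)
                + \sum_a s a / D a - \sum_a r a / D a) * Dt b.
Proof.
move=> m_neq0 m2 E D Dt; rewrite !sum3E /D /Dt /triple.
have s2 : s 2 = r 2 + 3 * (s 1 - r 1) by rewrite -E addrC subrK.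
by apply: forall_I3; rewrite /= m2 s2; field; rewrite !m_neq0.
Qed.

Theorem theorem4p1 (R : realType) (M : manifold3 R)
    (g : formfield M) (Q : endofield M) (nabla nablat : connection M)
    (hg : riemannian_metric g) (hQ : circulant_structure g Q)
    (hnabla : levi_civita g nabla)
    (hnablat : levi_civita (associated_metric g Q) nablat)
    (X Y : vfield M) (hX : smooth_vfield X) (hY : smooth_vfield Y)
    (p : M) (e : 'I_3 -> vfield M) (he : local_frame_at e p) :
  let gt := associated_metric g Q in
  let rho := ricci g nabla e in
  let rhot := ricci gt nablat e in
  let tau := metric_trace g e rho p in
  let taut := metric_trace gt e rhot p in
  let tau_star := metric_trace gt e rho p in
  let taut_star := metric_trace g e rhot p in
  rhot X Y p =
    rho X Y p
    + 3%:R^-1 * (taut_star - tau) * apply_form g X Y p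
    + 6%:R^-1 * (2%:R * taut - 2%:R * tau_star + taut_star - tau)
        * apply_form gt X Y p.
Proof.
move=> gt rho rhot tau taut tau_star taut_star.
have [c [sc cp Qc AB]] := circ_coordinates hQ p.
have Hg := metric_smooth_form hg; have Hgt := associated_smooth_form hg hQ.
pose w : 'I_3 -> 'rV[R]_3 := axis_plane (fun j => delta_mx 0 j).
pose F i := const_field c (w i).
pose m := triple (axis_scale g c) (plane_scale g c) (plane_scale g c).
have sF i : smooth_vfield_at (F i) p := smooth_const_field (w i) sc cp.
have sm b q (cq : cdom c q) : smooth_fun_at (m b) q := smooth_scale hg sc b cq.
have m0 b : m b p != 0 by rewrite gt_eqF // (scale_gt0 AB b cp).
have k0 b : triple 1 1 3 b != 0 :> R.
  by move: b; apply: forall_I3; rewrite /triple /= ?oner_neq0 ?pnatr_eq0.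
have kt0 b : triple 2 (-1) (-3) b != 0 :> R.
  by move: b; apply: forall_I3; rewrite /triple /= ?oppr_eq0 ?oner_neq0 ?pnatr_eq0.
have gF := metric_frame hg hQ sc Qc; have gtF := associated_frame hg hQ sc Qc.
have D0 b : triple 1 1 3 b * m b p != 0 by rewrite mulf_neq0.
have Dt0 b : triple 2 (-1) (-3) b * m b p != 0 by rewrite mulf_neq0.
have Trho : bitensorial_at p rho := ricci_bitensorial Hg hnabla he.
have Trhot : bitensorial_at p rhot := ricci_bitensorial Hgt hnablat he.
pose dm a i := vderive (F a) (m i) p.
pose ddm a b i := vderive (F a) (vderive (F b) (m i)) p.
pose ric b d := diag_ricci (triple 1 1 3) (m^~ p) dm ddm b d.
pose rict b d := diag_ricci (triple 2 (-1) (-3)) (m^~ p) dm ddm b d.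
have rhoE b d : rho (F b) (F d) p = ric b d.
  exact: (ricci_diagonal Hg hnabla sc sm gF cp D0 b d he).
have rhotE b d : rhot (F b) (F d) p = rict b d.
  exact: (ricci_diagonal Hgt hnablat sc sm gtF cp Dt0 b d he).
have ddmC a b i : ddm a b i = ddm b a i.
  exact: (vderive_const_comm (w a) (w b) sc cp (sm i p cp)).
(* Index 0 is the axis, and 3 the ratio of the squares of F_2 and F_1. *)
have rescale : rict 2 2 - ric 2 2 = 3 * (rict 1 1 - ric 1 1).
  have three : 3 != 0 :> R by rewrite pnatr_eq0.
  have kE : triple 1 1 3 2 = 3 * triple 1 1 3 1 :> R by rewrite /triple /= mulr1.
  have ktE : triple 2 (-1) (-3) 2 = 3 * triple 2 (-1) (-3) 1 :> R.
    by rewrite /triple /= mulrN1.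
  have mE : m 2 p = m 1 p by [].
  have dmE a : dm a 2 = dm a 1 by [].
  have ddmE a b : ddm a b 2 = ddm a b 1 by [].
  have n01 : 0 != 1 :> 'I_3 by []. have n02 : 0 != 2 :> 'I_3 by [].
  have n12 : 1 != 2 :> 'I_3 by [].
  exact: (diag_ricci_rescale k0 kt0 m0 ddmC n01 n02 n12 mE dmE ddmE three kE ktE).
have Tg := smooth_form_bitensorial p Hg; have Tgt := smooth_form_bitensorial p Hgt.
(* Both sides are bilinear tensors, so they are compared on the frame F only. *)
have Ttot := bitensorialD (bitensorialD Trho
   (bitensorialZ (3^-1 * (taut_star - tau)) Tg))
   (bitensorialZ (6^-1 * (2 * taut - 2 * tau_star + taut_star - tau)) Tgt).
have oF := orthogonal_frame Hg sF (gF p cp) D0.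
have trace_g := metric_trace_orth Hg sF (gF p cp) D0 _ he.
have trace_gt := metric_trace_orth Hgt sF (gtF p cp) Dt0 _ he.
have tauE : tau = \sum_a ric a a / (triple 1 1 3 a * m a p).
  by rewrite /tau (trace_g _ Trho); apply: eq_bigr => a _; congr (_ / _); exact: rhoE.
have taut_starE : taut_star = \sum_a rict a a / (triple 1 1 3 a * m a p).
  by rewrite /taut_star (trace_g _ Trhot); apply: eq_bigr => a _; congr (_ / _); exact: rhotE.
have tau_starE : tau_star = \sum_a ric a a / (triple 2 (-1) (-3) a * m a p).
  by rewrite /tau_star (trace_gt _ Trho); apply: eq_bigr => a _; congr (_ / _); exact: rhoE.
have tautE : taut = \sum_a rict a a / (triple 2 (-1) (-3) a * m a p).
  by rewrite /taut (trace_gt _ Trhot); apply: eq_bigr => a _; congr (_ / _); exact: rhotE.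
apply: (bitensor_ext Trhot Ttot oF _ (hX p) (hY p)) => b d.
rewrite (gF p cp b d) (gtF p cp b d) (rhotE b d) (rhoE b d).
have [<-|bd] := eqVneq b d; last first.
  by rewrite !mul0r !mulr0 !addr0; exact: diag_ricci_off_rescale.
rewrite !mul1r tauE tautE tau_starE taut_starE.
exact: (trace_coefficients (r := fun a => ric a a) (s := fun a => rict a a) m0
  (erefl : m 2 p = m 1 p) rescale).
Qed.
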